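(* For every integer $d\ge 1$ there exist a constant $c_d>0$, depending only on $d$, and an integer $n_0$ such that for all $n\ge n_0$ the reach (critical radius) of $i_n^d(S^d)$ as a subset of $\mathbb R^{k_n^d}$ satisfies $$r_c\big(i_n^d(S^d)\big)\ \ge\ c_d .$$
   Context: $S^d\subset\mathbb R^{d+1}$ is the unit sphere with its standard round metric $g_{S^d}$, volume measure $V_{g_{S^d}}$, total area $s_d=\frac{2\pi^{(d+1)/2}}{\Gamma((d+1)/2)}$, and Laplacian $\Delta_d$. For $n\ge1$, $\mathcal H_n^d$ is the space of spherical harmonics of level $n$, i.e. of real functions $\phi$ on $S^d$ with $\Delta_d\phi=-n(n+d-1)\phi$. Its dimension is $k_n^d=\frac{2n+d-1}{n+d-1}\binom{n+d-1}{d-1}$. Let $\phi_1^{n,d},\dots,\phi_{k_n^d}^{n,d}$ be an orthonormal basis of $\mathcal H_n^d$ with respect to the $L^2(S^d,V_{g_{S^d}})$ inner product. Define $$i_n^d:S^d\to\mathbb R^{k_n^d},\qquad i_n^d(x)=\sqrt{\tfrac{s_d}{k_n^d}}\,\big(\phi_1^{n,d}(x),\dots,\phi_{k_n^d}^{n,d}(x)\big).$$ One has $\|i_n^d(x)\|=1$ for all $x\in S^d$. For large $n$ this map is an immersion. For a compact smooth submanifold $N\subset\mathbb R^k$, the reach (critical radius) is $$r_c(N)=\inf_{x,y\in N,\ x\neq y}\frac{\|x-y\|^2}{2\,\|P_y^{\perp}(x-y)\|},$$ where $P_y^\perp$ is the orthogonal projection onto the normal space of $N$ at $y$ (the orthogonal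 complement of $T_yN$ in $\mathbb R^k$), and the quotient is $+\infty$ when the denominator vanishes. *)

(* Defs.v *)
From HB Require Import structures.
From mathcomp Require Import all_boot all_order all_algebra.
From mathcomp Require Import all_classical all_reals all_analysis.

Set Implicit Arguments.
Unset Strict Implicit.
Unset Printing Implicit Defensive.

Import Order.TTheory GRing.Theory Num.Theory.
Import numFieldNormedType.Exports.

Local Open Scope classical_set_scope.
Local Open Scope ring_scope.

(* Euclidean structure.  The norm `|x| that the library puts on 'rV[R]_k is the
   sup norm; it is used only through its topology. *)

Definition dotp (R : realType) (k : nat) (u v : 'rV[R]_k) : R :=
  \sum_(i < k) u 0 i * v 0 i.

Definition enorm (R : realType) (k : nat) (u : 'rV[R]_k) : R :=
  Num.sqrt (dotp u u).

Definition sphere (R : realType) (d : nat) : set 'rV[R]_d.+1 :=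
  [set x | enorm x = 1].

Definition partial_der (R : realType) (m : nat) (i : 'I_m) (f : 'rV[R]_m -> R)
    (u : 'rV[R]_m) : R :=
  'D_(delta_mx 0 i) f u.

(* f is of class C^r on the open set U *)
Fixpoint class_C (R : realType) (m : nat) (r : nat) (U : set 'rV[R]_m)
    (f : 'rV[R]_m -> R) : Prop :=
  match r with
  | 0 => forall u, U u -> {for u, continuous f}
  | r'.+1 => (forall u, U u -> differentiable f u) /\
             (forall i : 'I_m, class_C r' U (partial_der i f))
  end.

Definition smooth_on (R : realType) (m : nat) (U : set 'rV[R]_m)
    (f : 'rV[R]_m -> R) : Prop :=
  forall r : nat, class_C r U f.

(* psi restricted to U is a smooth local parametrization (an inverse chart) of
   S^d.  With row vectors, row i of the Jacobian 'J psi u is the i-th partial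
   derivative of psi at u, so that row_free means that psi is an immersion. *)
Definition sphere_param (R : realType) (d : nat) (U : set 'rV[R]_d)
    (psi : 'rV[R]_d -> 'rV[R]_d.+1) : Prop :=
  [/\ open U,
      forall j : 'I_d.+1, smooth_on U (fun u => psi u 0 j),
      forall u, U u -> sphere (psi u),
      set_inj U psi &
      forall u, U u -> row_free ('J psi u)].

(* The round metric in the chart psi, g_ij = <d_i psi, d_j psi>. *)
Definition round_metric (R : realType) (d : nat)
    (psi : 'rV[R]_d -> 'rV[R]_d.+1) (u : 'rV[R]_d) : 'M[R]_d :=
  'J psi u *m ('J psi u)^T.

Definition vol_density (R : realType) (d : nat)
    (psi : 'rV[R]_d -> 'rV[R]_d.+1) (u : 'rV[R]_d) : R :=
  Num.sqrt (\det (round_metric psi u)).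

(* The Laplace-Beltrami operator in the chart psi,
   (det g)^(-1/2) sum_ij d_i ((det g)^(1/2) g^ij d_j h). *)
Definition laplace_beltrami (R : realType) (d : nat)
    (psi : 'rV[R]_d -> 'rV[R]_d.+1) (h : 'rV[R]_d -> R) (u : 'rV[R]_d) : R :=
  (vol_density psi u)^-1 *
  \sum_(i < d) partial_der i (fun v => vol_density psi v *
     \sum_(j < d) invmx (round_metric psi v) i j * partial_der j h v) u.

(* Integral of a nonnegative Borel function against Lebesgue measure on R^m,
   written as an iterated integral (Tonelli). *)
Fixpoint lebesgue_int (R : realType) (m : nat) :
    ('rV[R]_m -> \bar R) -> \bar R :=
  match m with
  | 0 => fun f => f 0
  | m'.+1 => fun f =>
      (\int[@lebesgue_measure R]_t
         lebesgue_int (fun u : 'rV[R]_m' => f (row_mx t%:M u)))%E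
  end.

Definition borel_rV (R : realType) (k : nat) :=
  g_sigma_algebraType (@open 'rV[R]_k).

(* V is the Riemannian volume measure of the round metric: in every chart it is
   (det g)^(1/2) du.  V is a Borel measure on the ambient space, but only the
   Borel subsets of S^d are constrained and used. *)
Definition sphere_volume (R : realType) (d : nat)
    (V : {measure set (borel_rV R d.+1) -> \bar R}) : Prop :=
  forall (U : set 'rV[R]_d) (psi : 'rV[R]_d -> 'rV[R]_d.+1),
    sphere_param U psi ->
    forall B : set (borel_rV R d.+1), measurable B -> B `<=` psi @` U ->
    V B = lebesgue_int
            ((fun u => (vol_density psi u)%:E) \_ (U `&` psi @^-1` B)).

Definition sphere_area (R : realType) (d : nat)
    (V : {measure set (borel_rV R d.+1) -> \bar R}) : R :=
  fine (V (@sphere R d)).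

(* A function on S^d is represented by a function on R^(d+1) of which only the
   values on S^d matter.  Membership in H_n^d: smoothness and the equation
   Delta phi = - n (n + d - 1) phi, both read in charts. *)
Definition spherical_harmonic (R : realType) (d n : nat)
    (phi : 'rV[R]_d.+1 -> R) : Prop :=
  forall (U : set 'rV[R]_d) (psi : 'rV[R]_d -> 'rV[R]_d.+1),
    sphere_param U psi ->
    smooth_on U (phi \o psi) /\
    forall u, U u ->
      laplace_beltrami psi (phi \o psi) u
      = - (n * (n + d - 1))%N%:R * phi (psi u).

(* k_n^d; the division is exact when d >= 1 and n >= 1. *)
Definition harm_dim (d n : nat) : nat :=
  (((2 * n + d - 1) * 'C(n + d - 1, d - 1)) %/ (n + d - 1))%N.

Definition harm_orthonormal_basis (R : realType) (d n : nat)
    (V : {measure set (borel_rV R d.+1) -> \bar R})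
    (phi : 'I_(harm_dim d n) -> 'rV[R]_d.+1 -> R) : Prop :=
  [/\ forall i, spherical_harmonic n (phi i),
      forall i j,
        (\int[V]_(x in @sphere R d) (phi i x * phi j x)%:E
         = (i == j)%:R%:E)%E &
      forall f, spherical_harmonic n f ->
        exists a : 'I_(harm_dim d n) -> R,
          forall x, sphere x -> f x = \sum_i a i * phi i x].

Definition harm_map (R : realType) (d n : nat)
    (V : {measure set (borel_rV R d.+1) -> \bar R})
    (phi : 'I_(harm_dim d n) -> 'rV[R]_d.+1 -> R)
    (x : 'rV[R]_d.+1) : 'rV[R]_(harm_dim d n) :=
  Num.sqrt (sphere_area V / (harm_dim d n)%:R) *: \row_j phi j x.

(* T_y N: velocities at y of smooth curves ]-e, e[ -> N through y. *)
Definition tangent_space (R : realType) (k : nat) (N : set 'rV[R]_k)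
    (y : 'rV[R]_k) : set 'rV[R]_k :=
  [set v | exists (gamma : R -> 'rV[R]_k) (e : R),
     [/\ 0 < e,
         (forall t : R, `|t| < e ->
            N (gamma t) /\
            forall (j : 'I_k) (m : nat),
              derivable (derive1n m (fun s : R => gamma s 0 j)) t 1),
         gamma 0 = y &
         derive1 gamma 0 = v]].

Definition normal_space (R : realType) (k : nat) (N : set 'rV[R]_k)
    (y : 'rV[R]_k) : set 'rV[R]_k :=
  [set v | forall w, tangent_space N y w -> dotp v w = 0].

(* Orthogonal projection of v onto the linear subspace W. *)
Definition orth_proj (R : realType) (k : nat) (W : set 'rV[R]_k)
    (v : 'rV[R]_k) : 'rV[R]_k :=
  xget 0 [set p | W p /\ forall w, W w -> dotp (v - p) w = 0].

Definition reach_quotient (R : realType) (k : nat) (N : set 'rV[R]_k)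
    (x y : 'rV[R]_k) : \bar R :=
  let p := orth_proj (normal_space N y) (x - y) in
  if 2 * enorm p == 0 then +oo%E
  else (enorm (x - y) ^+ 2 / (2 * enorm p))%:E.

Definition reach (R : realType) (k : nat) (N : set 'rV[R]_k) : \bar R :=
  ereal_inf [set q | exists x y, [/\ N x, N y, x != y &
                                     q = reach_quotient N x y]].

(* Main.v *)
(* Let Z(x, y) = sum_i phi_i(x) phi_i(y).  Rotations preserve the round metric
   in charts, hence the volume and the space of harmonics, so Z is invariant and
   Z(x, y) = Z(x, x) F(<x, y>).  In the graph chart of a hemisphere the
   eigenvalue equation for F reads
     (1 - t^2) F'' - d t F' + lam F = 0,   lam = n (n + d - 1),
   with F regular at t = 1 and t = -1, F(1) = 1 and |F| <= 1.  The image has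
   inner products F(<x, y>); projecting the chord i(x) - i(y) off the tangent of
   the great circle through x and y leaves at most
     Q(t) = 2 (1 - F) - (d / lam) (1 - t^2) F'^2,   t = <x, y>,
   so a bound Q <= (d + 12)^2 (1 - F)^2, uniform in n, gives reach >= 1 / (d + 12).

   Put t1 = 1 - d / (4 lam).  On [t1, 1], F <= 1 forces t F' <= lam / d, and then
   Q - d (1 - F)^2 is nondecreasing and vanishes at 1.  On [0, t1] with d >= 2,
   the energy F^2 + (1 - t^2) F'^2 / lam increases with t and has dropped by
   (d - 1) / (16 d) at t1, so |F| <= 63/64.  For d = 1 the energy is constant and
   Q = (1 - F)^2.  Negative t reduce to positive ones by F(-t) = F(-1) F(t) with
   F(-1) = 1 or -1, which is uniqueness of the solution regular at 1. *)

Require Import Defs.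
From HB Require Import structures.
From mathcomp Require Import all_boot all_order all_algebra.
From mathcomp Require Import all_classical all_reals all_analysis.
From mathcomp Require Import measurable_realfun ring lra.

Import Order.TTheory GRing.Theory Num.Theory.
Import numFieldNormedType.Exports.

Local Open Scope classical_set_scope.
Local Open Scope ring_scope.

(** * Zonal solutions of the Gegenbauer equation *)

(** The obstacle is uniformity in n. F varies at angular scale 1/sqrt(lam), so near the pole no
    bound on the size of F or F' is uniform, while Q has to be compared with (1 - F)^2, which
    vanishes to second order in 1 - t. The two terms of Q vanish only to first order, so they must
    cancel exactly. They do because the equation at t = 1 forces F'(1) = lam / d. This number is
    also the squared speed of the image of a great circle, which is where the coefficient d / lam in
    Q comes from. The threshold t1 is placed at distance of order 1/lam from the pole: close enough
    that F stays above 1/2 there, far enough that the energy drop over [t1, 1] depends on d only.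
    Beyond t1 the gap 1 - F is then bounded below and no cancellation is required. The two regimes
    cost factors d and 144 = 12^2, and (d + 12)^2 dominates both. *)

Section Zonal.
Context {R : realType}.
Implicit Types (f g : R -> R) (t a b x y : R).

(** This and the next rules are stated for pointwise expressions and ring products, so that
    [derive_tac] can decompose a formula by its syntax; [is_derive_eq] then leaves an algebraic
    identity. *)
Lemma is_derive_opp f x (df : R) : is_derive x 1 f df ->
  is_derive x 1 (fun t => - f t) (- df).
Proof. by move=> h; exact: is_deriveN. Qed.

Lemma is_derive_add f g x (df dg : R) : is_derive x 1 f df -> is_derive x 1 g dg ->
  is_derive x 1 (fun t => f t + g t) (df + dg).
Proof. by move=> h k; exact: is_deriveD. Qed.

Lemma is_derive_mul f g x (df dg : R) : is_derive x 1 f df -> is_derive x 1 g dg ->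
  is_derive x 1 (fun t => f t * g t) (df * g x + f x * dg).
Proof.
move=> h k; have fg := is_deriveM h k; apply: (is_derive_eq fg).
by rewrite /GRing.scale /= addrC mulrC.
Qed.

Lemma is_derive_exp f n x (df : R) : is_derive x 1 f df ->
  is_derive x 1 (fun t => f t ^+ n) (n%:R * f x ^+ n.-1 * df).
Proof.
move=> h; elim: n => [|n ih].
  rewrite !mul0r [X in is_derive _ _ X _](_ : _ = cst 1); first exact: is_derive_cst.
  by apply/funext => t; rewrite expr0.
rewrite [X in is_derive _ _ X _](_ : _ = fun t => f t * f t ^+ n); last first.
  by apply/funext => t; rewrite exprS.
have fn := is_derive_mul _ _ _ _ _ h ih; apply: (is_derive_eq fn).
by case: n {ih fn} => [|n] /=; rewrite ?exprS -?natr1; ring.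
Qed.

Lemma is_derive_const (c : R) x : is_derive x 1 (fun _ : R => c) 0.
Proof. exact: is_derive_cst. Qed.

Lemma is_derive_var x : is_derive x 1 (fun t : R => t) 1.
Proof. exact: is_derive_id. Qed.

Lemma is_derive_sqrtf f x (df : R) : 0 < f x -> is_derive x 1 f df ->
  is_derive x 1 (fun t => Num.sqrt (f t)) (df / (2 * Num.sqrt (f x))).
Proof.
move=> f0 h; apply: is_derive_eq.
  exact: (@is_derive1_comp _ Num.sqrt f x _ _ (is_derive1_sqrt f0) h).
by rewrite mulrC.
Qed.

Lemma is_derive_mono f (df : R -> R) a b :
  (forall t, a <= t -> t <= b -> is_derive t 1 f (df t)) ->
  (forall t, a <= t -> t <= b -> 0 <= df t) -> a <= b -> f a <= f b.
Proof.
move=> fd df0; rewrite le_eqVlt => /predU1P[-> //|ab].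
have := @MVT _ f df _ _ ab; case.
- by move=> t; rewrite in_itv /= => /andP[/ltW at_ /ltW tb]; exact: fd.
- apply: derivable_within_continuous => t; rewrite in_itv /= => /andP[at_ tb].
  by have [] := fd _ at_ tb.
- move=> c; rewrite in_itv /= => /andP[/ltW ac /ltW cb] h.
  by rewrite -subr_ge0 h mulr_ge0 ?subr_ge0 ?(ltW ab) ?df0.
Qed.

Lemma near_left1 a (P : R -> Prop) : a < 1 -> (forall t, a <= t -> t < 1 -> P t) ->
  \forall t \near (1 : R)^'-, P t.
Proof.
move=> a1 h; near=> t; apply: h.
  by apply/ltW; near: t; exact: nbhs_left_gt.
by near: t; exact: nbhs_left_lt.
Unshelve. all: by end_near. Qed.

Lemma le_left_lim1 f a l : a < 1 -> (forall t, a <= t -> t < 1 -> f a <= f t) ->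
  f t @[t --> (1 : R)^'-] --> l -> f a <= l.
Proof.
move=> a1 h cf; apply: (cvgr_to_ge cf).
exact: near_left1 a1 h.
Qed.

(** The equation degenerates at 1 and F' is controlled only inside ]-1, 1[, so comparisons reaching
    the pole use the left limit at 1 as terminal value. *)
Lemma is_derive_mono_lim f (df : R -> R) a l : a < 1 ->
  (forall t, a <= t -> t < 1 -> is_derive t 1 f (df t)) ->
  (forall t, a <= t -> t < 1 -> 0 <= df t) ->
  f t @[t --> (1 : R)^'-] --> l -> f a <= l.
Proof.
move=> a1 fd df0; apply: le_left_lim1 => // t at_ t1.
apply: (is_derive_mono f df) => // s as_ st; [apply: fd|apply: df0] => //;
  exact: le_lt_trans st t1.
Qed.
End Zonal.

Ltac derive_tac := repeat first
  [ eassumption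
  | exact: is_derive_const
  | exact: is_derive_var
  | eapply is_derive_exp
  | eapply is_derive_opp
  | eapply is_derive_add
  | eapply is_derive_mul ].

Section Circle.
Context {R : realType}.

Lemma sqr_lt1 (t : R) : -1 < t < 1 -> 0 < 1 - t ^+ 2.
Proof. by move=> ?; nra. Qed.

Lemma is_derive_circle (t : R) : -1 < t < 1 ->
  is_derive t 1 (fun t => Num.sqrt (1 - t ^+ 2)) (- t / Num.sqrt (1 - t ^+ 2)).
Proof.
move=> t1; have w0 := sqr_lt1 _ t1.
have h : is_derive t 1 (fun t => 1 - t ^+ 2) (- (2 * t)).
  by eapply is_derive_eq; [derive_tac | rewrite /=; ring].
have hs := is_derive_sqrtf (fun t => 1 - t ^+ 2) t _ w0 h.
apply: (is_derive_eq hs).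
have sn : Num.sqrt (1 - t ^+ 2) != 0 by rewrite sqrtr_eq0 -ltNge.
by field.
Qed.

Lemma circle_cvg : Num.sqrt (1 - t ^+ 2) @[t --> (1 : R)^'-] --> (0 : R).
Proof.
have -> : 0 = Num.sqrt (1 - 1 ^+ 2) :> R by rewrite expr1n subrr sqrtr0.
apply: cvg_at_left_filter; apply: (@continuous_comp _ _ _ (fun t : R => 1 - t ^+ 2) Num.sqrt).
  by apply: cvgB; [exact: cvg_cst | exact: exprn_continuous].
exact: sqrt_continuous.
Qed.
End Circle.

(* The last two conditions are regularity at t = 1: in the angle theta = acos t,
   F tends to F 1 and its derivative - sqrt(1 - t^2) F' tends to 0. *)
Definition zonal_sol (R : realType) (d : nat) (lam : R) (F F' F'' : R -> R) : Prop :=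
  [/\ forall t : R, -1 < t < 1 -> is_derive t 1 F (F' t),
      forall t : R, -1 < t < 1 -> is_derive t 1 F' (F'' t),
      forall t : R, -1 < t < 1 ->
        (1 - t ^+ 2) * F'' t - d%:R * t * F' t + lam * F t = 0,
      F t @[t --> (1 : R)^'-] --> F 1 &
      Num.sqrt (1 - t ^+ 2) * F' t @[t --> (1 : R)^'-] --> (0 : R)].

Section Solution.
Context {R : realType} {d : nat} {lam : R} {F F' F'' : R -> R}.
Context (sol : zonal_sol R d lam F F' F'').
Context (d1 : (0 < d)%N).
Context (lam0 : 0 < lam).

Lemma zonal_sol_sq_cvg :
  (1 - t ^+ 2) * F' t ^+ 2 @[t --> (1 : R)^'-] --> (0 : R).
Proof.
case: sol => _ _ _ _ c.
have : (Num.sqrt (1 - t ^+ 2) * F' t) * (Num.sqrt (1 - t ^+ 2) * F' t)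
  @[t --> (1 : R)^'-] --> (0 * 0 : R) by exact: cvgM.
rewrite mulr0.
apply: cvg_trans; apply: near_eq_cvg.
near=> t.
have t0 : 0 < t by near: t; exact: nbhs_left_gt.
have t1 : t < 1 by near: t; exact: nbhs_left_lt.
have w0 : 0 < 1 - t ^+ 2 by apply: sqr_lt1; lra.
by rewrite -expr2 exprMn sqr_sqrtr ?ltW.
Unshelve. all: by end_near. Qed.

Lemma is_derive_energy (s : R) : -1 < s < 1 ->
  is_derive s 1 (fun t => F t ^+ 2 + (1 - t ^+ 2) * F' t ^+ 2 / lam)
    (2 * (d%:R - 1) * s * F' s ^+ 2 / lam).
Proof.
move=> s01; have [dF dF' ode _ _] := sol.
move: (dF _ s01) (dF' _ s01) (ode _ s01) => /= hF hF' hode.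
eapply is_derive_eq; first by derive_tac.
apply: (mulIf (lt0r_neq0 lam0)); rewrite /=.
(* Eliminating F through the equation turns the derivative formula into a rational identity. *)
have -> : F s = - ((1 - s ^+ 2) * F'' s - d%:R * s * F' s) / lam.
  by apply: (mulIf (lt0r_neq0 lam0)); rewrite divfK ?gt_eqF//; lra.
field; exact: lt0r_neq0.
Qed.

Lemma energy_cvg :
  F t ^+ 2 + (1 - t ^+ 2) * F' t ^+ 2 / lam @[t --> (1 : R)^'-] --> F 1 ^+ 2.
Proof.
have [_ _ _ cF _] := sol.
rewrite -[F 1 ^+ 2]addr0; apply: cvgD; first exact: cvgM.
rewrite -(mul0r lam^-1); apply: cvgMr_tmp; exact: zonal_sol_sq_cvg.
Qed.

Lemma energy_derive_ge0 (s : R) : 0 <= s -> 0 <= 2 * (d%:R - 1) * s * F' s ^+ 2 / lam.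
Proof.
have dR : 1 <= d%:R :> R by rewrite ler1n.
move=> s0; apply: divr_ge0; last exact: ltW.
by apply: mulr_ge0; [apply: mulr_ge0; [apply: mulr_ge0|]; lra|exact: sqr_ge0].
Qed.

Lemma energy_le (t : R) : 0 <= t < 1 ->
  F t ^+ 2 + (1 - t ^+ 2) * F' t ^+ 2 / lam <= F 1 ^+ 2.
Proof.
move=> /andP[t0 t1].
apply: (is_derive_mono_lim (fun t => F t ^+ 2 + (1 - t ^+ 2) * F' t ^+ 2 / lam)
  (fun t => 2 * (d%:R - 1) * t * F' t ^+ 2 / lam) t) => //.
- by move=> s ts s1; apply: is_derive_energy; lra.
- by move=> s ts s1; apply: energy_derive_ge0; lra.
- exact: energy_cvg.
Qed.

(* With w = sqrt(1 - t^2) the equation gives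
   (w^d (F' - a lam / d))' = lam w^(d - 2) (a t - F), and w^d F' vanishes at 1. *)
Lemma deriv_le (a t : R) : -1 < t < 1 -> (forall s, t <= s -> s < 1 -> F s <= a * s) ->
  F' t <= a * lam / d%:R.
Proof.
move=> t11 Fa; have [dF dF' ode cF cF'] := sol.
have dR : 1 <= d%:R :> R by rewrite ler1n.
have d0 : d%:R != 0 :> R by lra.
pose w (t : R) : R := Num.sqrt (1 - t ^+ 2).
have wd s : w s ^+ d = w s * w s ^+ d.-1 by rewrite -exprS prednK.
suff : w t ^+ d * (F' t - a * lam / d%:R) <= 0.
  rewrite pmulr_rle0 ?subr_le0// exprn_gt0// sqrtr_gt0; exact: sqr_lt1.
case/andP: t11 => tm1 t1.
apply: (is_derive_mono_lim (fun t => w t ^+ d * (F' t - a * lam / d%:R))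
  (fun t => w t ^+ d.-1 / w t * lam * (a * t - F t)) t) => //.
- move=> s ts s1; have s01 : -1 < s < 1 by lra.
  have w0 := sqr_lt1 _ s01.
  move: (dF _ s01) (dF' _ s01) (ode _ s01) => /= hF hF' hode.
  have hw : is_derive s 1 w (- s / w s) by exact: is_derive_circle.
  have wn : w s != 0 by rewrite sqrtr_eq0 -ltNge.
  have w2 : w s ^+ 2 = 1 - s ^+ 2 by rewrite sqr_sqrtr // ltW.
  eapply is_derive_eq; first by derive_tac.
  rewrite /= wd; move: (w s ^+ d.-1) => p.
  have -> : F s = - ((1 - s ^+ 2) * F'' s - d%:R * s * F' s) / lam.
    by apply: (mulIf (lt0r_neq0 lam0)); rewrite divfK ?gt_eqF//; lra.
  rewrite -w2. 
  by field; rewrite wn d0 lt0r_neq0.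
- move=> s ts s1; rewrite mulr_ge0 ?subr_ge0 ?Fa// mulr_ge0 ?(ltW lam0)//.
  by rewrite divr_ge0 ?exprn_ge0 ?sqrtr_ge0.
- have cw : w s @[s --> (1 : R)^'-] --> (0 : R) by exact: circle_cvg.
  have cwd n : w s ^+ n @[s --> (1 : R)^'-] --> (0 ^+ n : R).
    by apply: (@continuous_cvg _ _ _ _ _ w (fun x => x ^+ n)) => //; exact: exprn_continuous.
  (* Only w F' is known to tend to 0, so one factor w is kept with F'. For d = 1 the remaining power
     is 1, and the limit is still 0. *)
  have : w s ^+ d.-1 * (w s * F' s) - w s ^+ d * (a * lam / d%:R) @[s --> (1 : R)^'-]
      --> (0 ^+ d.-1 * 0 - 0 ^+ d * (a * lam / d%:R) : R).
    by apply: cvgB; [apply: cvgM | apply: cvgMr_tmp].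
  rewrite mulr0 (_ : 0 ^+ d = 0) ?mul0r ?subr0; last by rewrite expr0n gtn_eqF.
  apply: cvg_trans; apply: near_eq_cvg; apply: nearW => s.
  by rewrite /= wd; ring.
Qed.
End Solution.

(** The equation is linear; applying [deriv_le] to - F yields lower bounds on F'. *)
Lemma zonal_sol_opp (R : realType) d (lam : R) F F' F'' :
  zonal_sol R d lam F F' F'' ->
  zonal_sol R d lam (fun t => - F t) (fun t => - F' t) (fun t => - F'' t).
Proof.
case=> dF dF' ode cF cF'; split.
- by move=> t t1; apply: is_derive_opp; exact: dF.
- by move=> t t1; apply: is_derive_opp; exact: dF'.
- move=> t t1; have := ode _ t1; lra.
- exact: cvgN.
- by under eq_fun do rewrite mulrN; rewrite -oppr0; exact: cvgN.
Qed.

Section Normalized.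
Context {R : realType} {d : nat} {lam : R} {F F' F'' : R -> R}.
Context (sol : zonal_sol R d lam F F' F'') (d0 : (0 < d)%N) (dlam : d%:R <= lam).
Context (F1 : F 1 = 1) (Fle : forall t : R, 0 <= t < 1 -> F t <= 1).

Let Q (t : R) : R := 2 * (1 - F t) - (1 - t ^+ 2) * F' t ^+ 2 * d%:R / lam.
Let t1 : R := 1 - d%:R / (4 * lam).

Lemma natr_dim_ge1 : 1 <= d%:R :> R. Proof. by rewrite ler1n. Qed.

Lemma eigenvalue_gt0 : 0 < lam. Proof. by have := natr_dim_ge1; move: dlam; lra. Qed.

(** For s >= t one has F s <= 1 <= s / t, so [deriv_le] applies with a = 1 / t. *)
Lemma zonal_deriv_ub (t : R) : 0 < t < 1 -> F' t * t <= lam / d%:R.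
Proof.
move=> t01; have dR := natr_dim_ge1.
have h : F' t <= t^-1 * lam / d%:R.
  apply: (deriv_le sol) => //; [exact: eigenvalue_gt0|lra|move=> s ts s1].
  rewrite (le_trans (Fle s _))//; first by lra.
  by rewrite mulrC ler_pdivlMr ?mul1r//; lra.
have t0 : 0 < t by lra.
rewrite -ler_pdivlMr //; apply: le_trans h _.
by rewrite le_eqVlt; apply/orP; left; apply/eqP; field; lra.
Qed.

(** Integrate the preceding bound on F' over [t, 1[, where 1 / s <= 1 / t. *)
Lemma zonal_sub_le (t : R) : 0 < t < 1 -> 1 - F t <= lam / (d%:R * t) * (1 - t).
Proof.
move=> t01; have dR := natr_dim_ge1; set a := lam / _.
have [dF _ _ cF _] := sol.
suff : a * t - F t <= a * 1 - 1 by lra.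
apply: (is_derive_mono_lim (fun s => a * s - F s) (fun s => a - F' s) t).
- lra.
- move=> s ts s1; have hF := dF s ltac:(lra).
  by eapply is_derive_eq; [derive_tac | rewrite /=; ring].
- move=> s ts s1; rewrite subr_ge0 /a.
  have h := zonal_deriv_ub s ltac:(lra).
  have s0 : 0 < s by lra.
  have L0 : 0 < lam := eigenvalue_gt0.
  have a0 : lam / (d%:R * s) <= lam / (d%:R * t).
    by rewrite ler_pM2l// lef_pV2 ?posrE ?mulr_gt0 ?ler_pM2l//; lra.
  apply: le_trans a0; rewrite invfM mulrA ler_pdivlMr//.
- apply: cvgB; last by move: cF; rewrite F1.
  apply: cvgMl_tmp; apply: cvg_at_left_filter; exact: cvg_id.
Qed.

Lemma near_pole_ge : 3/4 <= t1.
Proof.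
have L0 := eigenvalue_gt0; rewrite /t1.
have dl := dlam.
have : d%:R / (4 * lam) <= 1/4 by rewrite ler_pdivrMr; lra.
lra.
Qed.

(** Here 1 - t <= d / (4 lam) and t >= 3/4, so [zonal_sub_le] gives 1 - F <= 1/3. *)
Lemma zonal_ge_half (t : R) : t1 <= t < 1 -> 1/2 <= F t.
Proof.
move=> t01; have h1 := near_pole_ge; have L0 := eigenvalue_gt0; have dR := natr_dim_ge1.
have h := zonal_sub_le t ltac:(lra).
have : lam / (d%:R * t) * (1 - t) <= 1/3.
  rewrite mulrAC ler_pdivrMr; last by apply: mulr_gt0; lra.
  have : lam * (1 - t) <= d%:R / 4.
    have h4 : 1 - t <= d%:R / (4 * lam) by move: t01; rewrite /t1; lra.
    by move: h4; rewrite ler_pdivlMr; lra.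
  by nra.
lra.
Qed.

(** [deriv_le] for - F with a = -1/2, since - F s <= -1/2 <= - s / 2 up to the pole. *)
Lemma zonal_deriv_lb (t : R) : t1 <= t < 1 -> lam / (2 * d%:R) <= F' t.
Proof.
move=> t01; have h1 := near_pole_ge; have L0 := eigenvalue_gt0; have dR := natr_dim_ge1.
have h : - F' t <= (- (1/2)) * lam / d%:R.
  apply: (deriv_le (zonal_sol_opp _ _ _ _ _ _ sol)) => //; first lra.
  by move=> s ts s1; have := zonal_ge_half s ltac:(lra); lra.
have -> : lam / (2 * d%:R) = 1/2 * lam / d%:R by field; lra.
lra.
Qed.

Lemma energy_t1 : F t1 ^+ 2 + (1 - t1 ^+ 2) * F' t1 ^+ 2 / lam <= 1 - (d%:R - 1) / (16 * d%:R).
Proof.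
have h1 := near_pole_ge; have L0 := eigenvalue_gt0; have dR := natr_dim_ge1.
have t11 : t1 < 1 by rewrite /t1 ltrBlDr ltrDl divr_gt0; lra.
(* A lower bound for the energy derivative on [t1, 1[, from F' >= lam / (2 d) and 2 s >= 1. Times
   the length d / (4 lam) it gives (d - 1) / (16 d). *)
pose a : R := (d%:R - 1) * lam / (4 * d%:R ^+ 2).
have [dF dF' ode cF _] := sol.
suff : F t1 ^+ 2 + (1 - t1 ^+ 2) * F' t1 ^+ 2 / lam - a * t1 <= 1 - a * 1.
  have : a * (1 - t1) = (d%:R - 1) / (16 * d%:R).
    by rewrite /a /t1; field; lra.
  lra.
apply: (is_derive_mono_lim (fun t => F t ^+ 2 + (1 - t ^+ 2) * F' t ^+ 2 / lam - a * t)
  (fun s => 2 * (d%:R - 1) * s * F' s ^+ 2 / lam - a)) => //.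
- move=> s ts s1; have hE := is_derive_energy sol L0 s ltac:(lra).
  by eapply is_derive_eq; [derive_tac | rewrite /=; ring].
- move=> s ts s1; rewrite subr_ge0 /a.
  have hF := zonal_deriv_lb s ltac:(lra).
  have q0 : 0 <= lam / (2 * d%:R) by rewrite divr_ge0; lra.
  have q2 : (lam / (2 * d%:R)) ^+ 2 <= F' s ^+ 2 by rewrite lerXn2r ?nnegrE//; lra.
  have -> : (d%:R - 1) * lam / (4 * d%:R ^+ 2) = (d%:R - 1) * ((lam / (2 * d%:R)) ^+ 2 / lam).
    by field; lra.
  have -> : 2 * (d%:R - 1) * s * F' s ^+ 2 / lam = (d%:R - 1) * (2 * s * F' s ^+ 2 / lam) by ring.
  apply: ler_wpM2l; first lra.
  apply: ler_wpM2r; first by rewrite invr_ge0; lra.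
  by have := sqr_ge0 (F' s); nra.
- apply: cvgB; first by have := energy_cvg sol; rewrite F1 expr1n.
  apply: cvgMl_tmp; apply: cvg_at_left_filter; exact: cvg_id.
Qed.

(* The equation gives (Q - d (1 - F)^2)' = 2 (d - 1) F' (1 - t F' d / lam). *)
Lemma zonal_near (t : R) : t1 <= t < 1 -> Q t <= d%:R * (1 - F t) ^+ 2.
Proof.
move=> t01; have h1 := near_pole_ge; have L0 := eigenvalue_gt0; have dR := natr_dim_ge1.
have [dF dF' ode cF _] := sol.
suff : Q t - d%:R * (1 - F t) ^+ 2 <= 0 by lra.
rewrite /Q.
apply: (is_derive_mono_lim
  (fun t => 2 * (1 - F t) - (1 - t ^+ 2) * F' t ^+ 2 * d%:R / lam - d%:R * (1 - F t) ^+ 2)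
  (fun s => 2 * F' s * (d%:R - 1) * (1 - s * (F' s * d%:R / lam)))).
- lra.
- move=> s ts s1; have s01 : -1 < s < 1 by lra.
  move: (dF _ s01) (dF' _ s01) (ode _ s01) => /= hF hF' hode.
  eapply is_derive_eq; first by derive_tac.
  have -> : F s = - ((1 - s ^+ 2) * F'' s - d%:R * s * F' s) / lam.
    by apply: (mulIf (lt0r_neq0 L0)); rewrite divfK ?gt_eqF//; lra.
  by rewrite /=; field; lra.
- move=> s ts s1; have hl := zonal_deriv_lb s ltac:(lra).
  have hu := zonal_deriv_ub s ltac:(lra).
  have q0 : 0 <= lam / (2 * d%:R) by rewrite divr_ge0; lra.
  rewrite !mulr_ge0//; try lra.
  by rewrite subr_ge0 mulrA ler_pdivrMr// mul1r mulrA -ler_pdivlMr ?(mulrC s)//; lra.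
- have c1 : 1 - F s @[s --> (1 : R)^'-] --> (0 : R).
    by rewrite -(subrr 1); apply: cvgB; [exact: cvg_cst | move: cF; rewrite F1].
  rewrite [X in _ --> X](_ : _ = 2 * 0 - 0 * d%:R / lam - d%:R * (0 * 0)); last by ring.
  apply: cvgB; last by apply: cvgMl_tmp; exact: cvgM.
  apply: cvgB; first exact: cvgMl_tmp.
  by do 2 apply: cvgMr_tmp; exact: zonal_sol_sq_cvg sol.
Qed.

(** The energy at t1 is at most 1 - 1/32 when d >= 2, and 31/32 <= (63/64)^2. The bound is on F^2
    because the odd case of [zonal_estimate] needs F bounded away from -1 as well. *)
Lemma zonal_far (t : R) : (1 < d)%N -> 0 <= t <= t1 -> F t ^+ 2 <= (63/64) ^+ 2.
Proof.
move=> d2 t01; have h1 := near_pole_ge; have L0 := eigenvalue_gt0.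
have dR : 2 <= d%:R :> R by rewrite ler_nat.
have t11 : t1 < 1 by rewrite /t1 ltrBlDr ltrDl divr_gt0; lra.
have h : F t ^+ 2 + (1 - t ^+ 2) * F' t ^+ 2 / lam <=
         F t1 ^+ 2 + (1 - t1 ^+ 2) * F' t1 ^+ 2 / lam.
  apply: (is_derive_mono (fun t => F t ^+ 2 + (1 - t ^+ 2) * F' t ^+ 2 / lam)
    (fun t => 2 * (d%:R - 1) * t * F' t ^+ 2 / lam)); last lra.
    by move=> s ts s1; apply: (is_derive_energy sol) => //; lra.
  by move=> s ts s1; apply: energy_derive_ge0 => //; lra.
have hE := energy_t1.
have : 1/32 <= (d%:R - 1) / (16 * d%:R) :> R by rewrite ler_pdivlMr; lra.
have : 0 <= (1 - t ^+ 2) * F' t ^+ 2 / lam.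
  apply: divr_ge0; last lra.
  by apply: mulr_ge0; [nra | exact: sqr_ge0].
lra.
Qed.

Lemma zonal_circle (t : R) : d = 1%N -> 0 <= t < 1 -> Q t <= (1 - F t) ^+ 2.
Proof.
move=> d1 t01; have L0 := eigenvalue_gt0.
(* For d = 1 the energy has derivative 0, so its opposite is nondecreasing too; this gives the
   reverse of [energy_le]. *)
have : - (F t ^+ 2 + (1 - t ^+ 2) * F' t ^+ 2 / lam) <= - 1.
  apply: (is_derive_mono_lim (fun t => - (F t ^+ 2 + (1 - t ^+ 2) * F' t ^+ 2 / lam))
    (fun=> 0)) => //.
  - lra.
  - move=> s ts s1; have hE := is_derive_energy sol L0 s ltac:(lra).
    by eapply is_derive_eq; [derive_tac | rewrite d1 /=; ring].
  - by apply: cvgN; have := energy_cvg sol; rewrite F1 expr1n.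
by rewrite /Q d1; lra.
Qed.

Lemma zonal_half (t : R) : 0 <= t < 1 -> Q t <= (d%:R + 12) ^+ 2 * (1 - F t) ^+ 2.
Proof.
move=> t01; have L0 := eigenvalue_gt0; have dR := natr_dim_ge1.
have G2 := sqr_ge0 (1 - F t).
have [tt1|t1t] := leP t1 t.
  apply: le_trans (zonal_near t _) _; first lra.
  by apply: ler_wpM2r => //; nra.
have [d1|d2] : d = 1%N \/ (1 < d)%N.
  by case: d d0 => // -[|n] _; [left|right].
  apply: le_trans (zonal_circle t d1 t01) _.
  by rewrite -{1}[_ ^+ 2]mul1r; apply: ler_wpM2r => //; nra.
have hf := zonal_far t d2 ltac:(lra).
have F63 : F t <= 63/64.
  by have := @ler_sqrt R; nra.
have : 0 <= (1 - t ^+ 2) * F' t ^+ 2 * d%:R / lam.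
  apply: divr_ge0; last lra.
  by apply: mulr_ge0; [apply: mulr_ge0; [nra | exact: sqr_ge0]|lra].
(* Since 1 - F >= 1/64, already 144 (1 - F) >= 144/64 >= 2. *)
have : 2 * (1 - F t) <= 144 * (1 - F t) ^+ 2 by nra.
have : 144 * (1 - F t) ^+ 2 <= (d%:R + 12) ^+ 2 * (1 - F t) ^+ 2.
  by apply: ler_wpM2r => //; nra.
rewrite /Q; lra.
Qed.
End Normalized.

Lemma zonal_sol_sub (R : realType) d (lam a : R) F F' F'' G G' G'' :
  zonal_sol R d lam F F' F'' -> zonal_sol R d lam G G' G'' ->
  zonal_sol R d lam (fun t => F t - a * G t) (fun t => F' t - a * G' t)
    (fun t => F'' t - a * G'' t).
Proof.
case=> dF dF' odeF cF cF' [dG dG' odeG cG cG']; split.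
- move=> t t1; have hF := dF t t1; have hG := dG t t1.
  by eapply is_derive_eq; [derive_tac | rewrite /=; ring].
- move=> t t1; have hF := dF' t t1; have hG := dG' t t1.
  by eapply is_derive_eq; [derive_tac | rewrite /=; ring].
- move=> t t1; have h1 := odeF t t1; have h2 := odeG t t1.
  rewrite -[RHS](subrr 0) -{1}h1 -[in RHS](mulr0 a) -h2; ring.
- by apply: cvgB => //; exact: cvgMl_tmp.
- under eq_fun do rewrite mulrBr mulrCA.
  by rewrite -(subrr 0) -[X in _ - X](mulr0 a); apply: cvgB => //; exact: cvgMl_tmp.
Qed.

Section Estimate.
Context {R : realType} {d : nat} {lam : R} {F F' F'' : R -> R}.
Context (sol : zonal_sol R d lam F F' F'').
Context (sol_opp : zonal_sol R d lam (fun t => F (- t)) (fun t => - F' (- t))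
                     (fun t => F'' (- t))).
Context (d0 : (0 < d)%N) (dlam : d%:R <= lam).
Context (F1 : F 1 = 1) (Fle : forall t : R, -1 <= t <= 1 -> F t <= 1).

Let Fle01 (t : R) : 0 <= t < 1 -> F t <= 1. Proof. by move=> ?; apply: Fle; lra. Qed.
Let L0 : 0 < lam. Proof. exact: (eigenvalue_gt0 d0 dlam). Qed.

(* F(-t) - F(-1) F(t) is a regular solution with zero energy at 1. *)
Lemma zonal_reflect (t : R) : 0 <= t < 1 ->
  F (- t) = F (-1) * F t /\ F' (- t) = - F (-1) * F' t.
Proof.
move=> t01; set a := F (-1).
have h := energy_le (zonal_sol_sub _ _ _ a _ _ _ _ _ _ sol_opp sol) d0 L0 t t01.
move: h; rewrite F1 mulr1 subrr expr0n /= => h.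
have w0 : 0 < (1 - t ^+ 2) / lam by rewrite divr_gt0 ?L0//; nra.
rewrite mulrAC in h.
have s1 := sqr_ge0 (F (- t) - a * F t).
have s2 := sqr_ge0 (- F' (- t) - a * F' t).
have s3 := mulr_ge0 (ltW w0) s2.
have /eqP : (F (- t) - a * F t) ^+ 2 = 0 by lra.
have : (1 - t ^+ 2) / lam * (- F' (- t) - a * F' t) ^+ 2 = 0 by lra.
move/eqP; rewrite mulf_eq0 (gt_eqF w0) /= !sqrf_eq0 => /eqP e1 /eqP e2.
by split; lra.
Qed.

(* Otherwise F and F' vanish at 0; since (1 - t^2)^(d - 1) times the energy is
   nonincreasing on [0, 1[, F would vanish identically there. *)
Lemma zonal_antipode : F (-1) ^+ 2 = 1.
Proof.
have L := L0; have dR : 1 <= d%:R :> R by rewrite ler1n.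
have [e1 e2] := zonal_reflect 0 ltac:(lra).
rewrite oppr0 in e1 e2; set a := F (-1) in e1 e2 *.
apply/eqP; case: eqP => // a1; exfalso.
have F00 : F 0 = 0.
  have : (a - 1) * F 0 = 0 by lra.
  move/eqP; rewrite mulf_eq0 => /orP[/eqP aa|/eqP//].
  by case: a1; rewrite (_ : a = 1) ?expr1n//; lra.
have F'00 : F' 0 = 0.
  have : (a + 1) * F' 0 = 0 by lra.
  move/eqP; rewrite mulf_eq0 => /orP[/eqP aa|/eqP//].
  by case: a1; rewrite (_ : a = -1) ?sqrrN ?expr1n//; lra.
pose t1 : R := 1 - d%:R / (4 * lam).
have t34 : 3 / 4 <= t1 := near_pole_ge d0 dlam.
have t11 : t1 < 1 by rewrite /t1 ltrBlDr ltrDl divr_gt0; lra.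
have [dF dF' ode cF _] := sol.
have : - ((1 - 0 ^+ 2) ^+ d.-1 * (F 0 ^+ 2 + (1 - 0 ^+ 2) * F' 0 ^+ 2 / lam)) <=
  - ((1 - t1 ^+ 2) ^+ d.-1 * (F t1 ^+ 2 + (1 - t1 ^+ 2) * F' t1 ^+ 2 / lam)).
  apply: (is_derive_mono
    (fun t => - ((1 - t ^+ 2) ^+ d.-1 * (F t ^+ 2 + (1 - t ^+ 2) * F' t ^+ 2 / lam)))
    (* The weight (1 - t^2)^(d - 1) is chosen so that the F'^2 terms cancel. For d = 1 the truncated
       exponent [d.-2] is harmless, as the factor [d.-1%:R] is 0. *)
    (fun t => 2 * t * d.-1%:R * (1 - t ^+ 2) ^+ d.-2 * F t ^+ 2)); last lra.
  - move=> s s0 s1; have s01 : -1 < s < 1 by lra.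
    have hE := is_derive_energy sol L0 s s01.
    eapply is_derive_eq; first by derive_tac.
    rewrite /=; have -> : d%:R - 1 = d.-1%:R :> R by rewrite -[d in LHS](prednK d0) -natr1 addrK.
    case: d.-1 => [|e] /=; rewrite ?expr0 ?exprS; field; exact: lt0r_neq0.
  - move=> s s0 s1; apply: mulr_ge0; last exact: sqr_ge0.
    apply: mulr_ge0; last by apply: exprn_ge0; nra.
    by apply: mulr_ge0 => //; lra.
rewrite F00 F'00 !expr0n /= mulr0 mul0r addr0 mulr0 oppr0 oppr_ge0.
rewrite pmulr_rle0; last by apply: exprn_gt0; nra.
have : 0 <= (1 - t1 ^+ 2) * F' t1 ^+ 2 / lam.
  by apply: divr_ge0; [apply: mulr_ge0; [nra|exact: sqr_ge0]|lra].
have : 1/2 <= F t1 by apply: (zonal_ge_half sol d0 dlam F1 Fle01); rewrite lexx.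
by nra.
Qed.

Lemma zonal_estimate (t : R) : -1 <= t < 1 ->
  2 * (1 - F t) - (1 - t ^+ 2) * F' t ^+ 2 * d%:R / lam <=
    (d%:R + 12) ^+ 2 * (1 - F t) ^+ 2.
Proof.
move=> t11; have L := L0; have dR : 1 <= d%:R :> R by rewrite ler1n.
have [t0|t0] := leP 0 t.
  by apply: (zonal_half sol d0 dlam F1 Fle01); lra.
have K144 : 144 <= (d%:R + 12) ^+ 2 :> R by nra.
have a2 := zonal_antipode.
(* [zonal_reflect] covers only the interior; at the antipode Q reduces to 2 (1 - F(-1)), which is 0
   or 4. *)
have [tm|tm] := eqVneq t (-1).
  rewrite tm sqrrN expr1n subrr !mul0r subr0.
  have [a|a] : F (-1) = 1 \/ F (-1) = -1.
    by move/eqP : a2; rewrite sqrf_eq1 => /orP[] /eqP ->; [left|right].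
    by rewrite a subrr expr0n /= !mulr0.
  by rewrite a; nra.
have t1 : -1 < t by rewrite lt_neqAle eq_sym tm; lra.
pose s := - t; have ts : t = - s by rewrite /s opprK.
have s01 : 0 <= s < 1 by rewrite /s; lra.
have [e1 e2] := zonal_reflect s s01.
have hs := zonal_half sol d0 dlam F1 Fle01 s s01.
rewrite ts sqrrN e1 e2 exprMn (sqrrN (F (-1))) a2 mul1r.
have [a|a] : F (-1) = 1 \/ F (-1) = -1.
  by move/eqP : a2; rewrite sqrf_eq1 => /orP[] /eqP ->; [left|right].
  by rewrite a mul1r.
(* Odd case: the inequality at - s involves 1 + F(s), so F must now be kept away from -1 on [0,
   1[. *)
rewrite a mulN1r opprK.
have G2 := sqr_ge0 (1 + F s).
have [d1|d2] : d = 1%N \/ (1 < d)%N.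
  by case: d d0 => // -[|n] _; [left|right].
  (* Rearranged, this says (1 - s^2) F'^2 / lam >= 1 - F^2, which does not see the sign of F. *)
  have hc := zonal_circle sol d0 dlam F1 s d1 s01.
  have : 1 * (1 + F s) ^+ 2 <= (d%:R + 12) ^+ 2 * (1 + F s) ^+ 2.
    by apply: ler_wpM2r => //; lra.
  lra.
have X0 : 0 <= (1 - s ^+ 2) * F' s ^+ 2 * d%:R / lam.
  apply: divr_ge0; last lra.
  by apply: mulr_ge0; [apply: mulr_ge0; [nra | exact: sqr_ge0]|lra].
have : 144 * (1 + F s) ^+ 2 <= (d%:R + 12) ^+ 2 * (1 + F s) ^+ 2.
  by apply: ler_wpM2r.
suff : 2 * (1 + F s) <= 144 * (1 + F s) ^+ 2 by lra.
have [st1|t1s] := leP (1 - d%:R / (4 * lam)) s.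
  have : 1/2 <= F s by apply: (zonal_ge_half sol d0 dlam F1 Fle01); lra.
  by nra.
have hf := zonal_far sol d0 dlam F1 Fle01 s d2 ltac:(lra).
have : -63/64 <= F s by nra.
by nra.
Qed.

(** Prepares the norm of the tangent vector: with s^2 = 1 - t^2 the left side is a squared chord,
    and the factor in front of s^2 tends to lam / d as t tends to 1. *)
Lemma zonal_quotient_le (t : R) : 0 < t < 1 ->
  2 * (1 - F t) <= lam / d%:R * (2 / (t * (1 + t))) * (1 - t ^+ 2).
Proof.
move=> t01; have dR : 1 <= d%:R :> R by rewrite ler1n.
have h := zonal_sub_le sol d0 dlam F1 Fle01 t t01.
have -> : lam / d%:R * (2 / (t * (1 + t))) * (1 - t ^+ 2) =
  2 * (lam / (d%:R * t) * (1 - t)) by field; lra.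
lra.
Qed.
End Estimate.

(** * Orthogonal maps *)

Section Dotp.
Context {R : realType} {k : nat}.
Implicit Types (u v w a b : 'rV[R]_k) (G : 'M[R]_k).

Lemma dotpE u v : dotp u v = (u *m v^T) 0 0.
Proof. by rewrite mxE; apply: eq_bigr => i _; rewrite mxE. Qed.

Lemma dotpC u v : dotp u v = dotp v u.
Proof. by apply: eq_bigr => i _; rewrite mulrC. Qed.

Lemma dotpDl u v w : dotp (u + v) w = dotp u w + dotp v w.
Proof. by rewrite !dotpE mulmxDl mxE. Qed.

Lemma dotpNl u w : dotp (- u) w = - dotp u w.
Proof. by rewrite !dotpE mulNmx mxE. Qed.

Lemma dotpBl u v w : dotp (u - v) w = dotp u w - dotp v w.
Proof. by rewrite dotpDl dotpNl. Qed.

Lemma dotpZl (c : R) u w : dotp (c *: u) w = c * dotp u w.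
Proof. by rewrite !dotpE -scalemxAl mxE. Qed.

Lemma dotpDr u v w : dotp w (u + v) = dotp w u + dotp w v.
Proof. by rewrite !(dotpC w) dotpDl. Qed.

Lemma dotpBr u v w : dotp w (u - v) = dotp w u - dotp w v.
Proof. by rewrite !(dotpC w) dotpBl. Qed.

Lemma dotpZr (c : R) u w : dotp w (c *: u) = c * dotp w u.
Proof. by rewrite !(dotpC w) dotpZl. Qed.

Lemma dotp_ge0 u : 0 <= dotp u u.
Proof. by apply: sumr_ge0 => i _; rewrite -expr2 sqr_ge0. Qed.

Lemma dotp_eq0 u : (dotp u u == 0) = (u == 0).
Proof.
apply/eqP/eqP => [h|->]; last by rewrite /dotp big1 // => i _; rewrite mxE mul0r.
apply/rowP => i; rewrite mxE.
have /allP h2 : all (fun j => true ==> (u 0 j * u 0 j == 0)) (index_enum 'I_k).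
  by rewrite -psumr_eq0; [exact/eqP | move=> j _; rewrite -expr2 sqr_ge0].
by have := h2 i (mem_index_enum i); rewrite /= mulf_eq0 orbb => /eqP.
Qed.

Lemma dotp_delta u i : dotp u (delta_mx 0 i) = u 0 i.
Proof.
rewrite /dotp (bigD1 i) //= big1 => [|j ji]; last first.
  by rewrite mxE eqxx (negPf ji) mulr0.
by rewrite mxE !eqxx mulr1 addr0.
Qed.

Lemma enorm_sqr u : enorm u ^+ 2 = dotp u u.
Proof. by rewrite sqr_sqrtr ?dotp_ge0. Qed.

Lemma enorm_ge0 u : 0 <= enorm u. Proof. exact: sqrtr_ge0. Qed.

Lemma dotp_CS u v : dotp u v ^+ 2 <= dotp u u * dotp v v.
Proof.
have [/eqP|v0] := eqVneq (dotp v v) 0.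
  rewrite dotp_eq0 => /eqP ->.
  by rewrite -[X in dotp _ X](scale0r u) dotpZr mul0r expr0n /= mulr_ge0 ?dotp_ge0.
have vp : 0 < dotp v v by rewrite lt_neqAle eq_sym v0 dotp_ge0.
have := dotp_ge0 (dotp v v *: u - dotp u v *: v).
rewrite (_ : dotp _ _ = dotp v v * (dotp u u * dotp v v - dotp u v ^+ 2)); last first.
  by rewrite !(dotpBl, dotpBr, dotpZl, dotpZr) (dotpC v u); ring.
by rewrite pmulr_rge0 // subr_ge0.
Qed.

Lemma dotp_axis (i j : 'I_k) :
  dotp (delta_mx 0 i : 'rV[R]_k) (delta_mx 0 j) = (i == j)%:R.
Proof. by rewrite dotp_delta mxE eqxx eq_sym. Qed.

(* Taking r = <v, tau> / mu makes an upper bound on |tau| suffice. *)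
Lemma projection_bound v p tau (mu : R) :
  0 < mu -> dotp tau tau <= mu -> dotp p tau = 0 -> dotp (v - p) p = 0 ->
  dotp p p <= dotp v v - dotp v tau ^+ 2 / mu.
Proof.
move=> mu0 tau_mu ptau vp; set r := dotp v tau / mu.
(* As v - p and tau are both orthogonal to p, subtracting a multiple of tau from v does not change
   its product with p; Cauchy-Schwarz then gives |p| <= |v - r tau|. *)
have pp : dotp p p = dotp (v - r *: tau) p.
  by move: vp; rewrite !dotpBl dotpZl (dotpC tau) ptau; lra.
have cs := dotp_CS (v - r *: tau) p; rewrite -pp in cs.
have p0 := dotp_ge0 p.
have w0 := dotp_ge0 (v - r *: tau).
have le1 : dotp p p <= dotp (v - r *: tau) (v - r *: tau).
  have [//|lt1] := leP (dotp p p) (dotp (v - r *: tau) (v - r *: tau)).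
  by nra.
apply: le_trans le1 _.
rewrite !(dotpBl, dotpBr, dotpZl, dotpZr) (dotpC tau v).
have : r * (r * dotp tau tau) <= r * (r * mu).
  by have r2 := sqr_ge0 r; have := ler_wpM2l r2 tau_mu; rewrite expr2 !mulrA.
have rmu : r * mu = dotp v tau by rewrite divfK ?gt_eqF.
have -> : dotp v tau ^+ 2 / mu = r * dotp v tau by rewrite /r expr2; ring.
by rewrite rmu; lra.
Qed.

Definition orthomx G := G *m G^T = 1%:M.

Lemma orthomxT G : orthomx G -> G^T *m G = 1%:M.
Proof. exact: mulmx1C. Qed.

Lemma orthomx_tr G : orthomx G -> orthomx G^T.
Proof. by move=> h; rewrite /orthomx trmxK; exact: orthomxT. Qed.

Lemma orthomx1 : orthomx 1%:M. Proof. by rewrite /orthomx trmx1 mulmx1. Qed.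

Lemma orthomxM G H : orthomx G -> orthomx H -> orthomx (G *m H).
Proof. by move=> hG hH; rewrite /orthomx trmx_mul mulmxA -(mulmxA G) hH mulmx1. Qed.

Lemma orthomxK m G (u : 'M[R]_(m, k)) : orthomx G -> u *m G *m G^T = u.
Proof. by move=> h; rewrite -mulmxA h mulmx1. Qed.

Lemma orthomxVK m G (u : 'M[R]_(m, k)) : orthomx G -> u *m G^T *m G = u.
Proof. by move=> h; rewrite -mulmxA orthomxT// mulmx1. Qed.

Lemma dotp_ortho G u v : orthomx G -> dotp (u *m G) (v *m G) = dotp u v.
Proof. by move=> h; rewrite !dotpE trmx_mul mulmxA orthomxK. Qed.

(** Polarization. The hypothesis concerns squares only because rotation invariance of integrals is
    established for nonnegative integrands. *)
Lemma dotp_isometry_ortho (A : 'M[R]_k) :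
  (forall b, dotp (b *m A) (b *m A) = dotp b b) -> orthomx A.
Proof.
move=> iso.
have pol b c : dotp (b *m A) (c *m A) = dotp b c.
  have := iso (b + c); rewrite mulmxDl !(dotpDl, dotpDr) !iso.
  by rewrite (dotpC (c *m A)) (dotpC c); lra.
apply/matrixP => i j; rewrite mxE.
have := pol (delta_mx 0 i) (delta_mx 0 j).
rewrite -!rowE [RHS]/dotp (bigD1 i) //= big1 => [|l li]; last by rewrite mxE eqxx (negPf li) mul0r.
rewrite !mxE !eqxx mul1r addr0 /= => <-; apply: eq_bigr => l _; by rewrite !mxE.
Qed.

(** The reflection in the hyperplane orthogonal to a - b, or the identity when a = b. *)
Lemma exists_reflection a b : dotp a a = dotp b b ->
  exists G, [/\ orthomx G, a *m G = b & forall z, dotp z a = dotp z b -> z *m G = z].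
Proof.
move=> ab; have [->|nab] := eqVneq a b.
  by exists 1%:M; split; [exact: orthomx1 | rewrite mulmx1 | move=> z _; rewrite mulmx1].
pose v := a - b; pose c := 2 / dotp v v.
have v0 : dotp v v != 0 by rewrite dotp_eq0 subr_eq0.
pose G := 1%:M - c *: (v^T *m v).
have act z : z *m G = z - (c * dotp z v) *: v.
  rewrite /G mulmxBr mulmx1 -scalemxAr mulmxA dotpE.
  by rewrite [z *m v^T]mx11_scalar mul_scalar_mx scalerA -mx11_scalar.
exists G; split.
- have Gt : G^T = G by rewrite /G linearB /= trmx1 linearZ /= trmx_mul trmxK.
  rewrite /orthomx Gt; apply/row_matrixP => i; rewrite row_mul !rowE mulmx1.
  set z := delta_mx _ _; rewrite act act -addrA dotpBl dotpZl -opprD -scalerDl.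
  rewrite [X in X *: v](_ : _ = 0) ?scale0r ?subr0// /c.
  by field.
- rewrite act; suff -> : c * dotp a v = 1 by rewrite scale1r /v opprB addrC subrK.
  have : dotp v v = 2 * dotp a v.
    by rewrite /v !(dotpBl, dotpBr) (dotpC b a) ab; ring.
  rewrite /c => vv; apply: (mulfI v0); rewrite mulr1 mulrA mulrCA mulfV// mulr1.
  by rewrite vv.
- by move=> z h; rewrite act /v dotpBr h subrr mulr0 scale0r subr0.
Qed.

(** One reflection moves a to a'. The second moves the image of b to b' and fixes a', because a' has
    the same product with both. *)
Lemma exists_ortho_pair a b a' b' :
  dotp a a = dotp a' a' -> dotp b b = dotp b' b' -> dotp a b = dotp a' b' ->
  exists G, [/\ orthomx G, a *m G = a' & b *m G = b'].
Proof.
move=> aa bb ab; have [G [oG aG _]] := exists_reflection _ _ aa.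
have [|H [oH bH fH]] := exists_reflection (b *m G) b'; first by rewrite dotp_ortho.
exists (G *m H); split; [exact: orthomxM | | by rewrite mulmxA].
by rewrite mulmxA aG fH // -ab -aG dotp_ortho.
Qed.
End Dotp.

(** * Functions of class C^r *)

(** The first-order expansion of f at x is one for g, and uniqueness of the differential identifies
    it with the differential of g. *)
Lemma near_eq_differentiable (R : realType) (V W : normedModType R)
    (f g : V -> W) (x : V) :
  (\forall y \near x, f y = g y) -> differentiable f x -> differentiable g x.
Proof.
move=> fg df; have [cdf hdf] := (diff_locallyP _ _).1 df.
have gdf : g \o shift x = cst (g x) + 'd f x +o_ 0 id.
  apply/eqaddoP => e e0; move/eqaddoP : hdf => /(_ _ e0) hdf.
  have fgx : f x = g x := nbhs_singleton fg.
  have fg0 : \forall y \near 0, f (y + x) = g (y + x).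
    by move: fg; rewrite (near_shift 0 x) subr0.
  near=> y.
  have -> : (g \o shift x - (cst (g x) + 'd f x)) y =
            (f \o shift x - (cst (f x) + 'd f x)) y.
    have := near fg0 y; rewrite -fgx /= => h.
    rewrite /GRing.add /GRing.opp /=.
    by congr (_ - _); apply/esym; apply: h.
  by near: y.
have dg := diff_unique cdf gdf.
by apply/diff_locallyP; rewrite dg.
Unshelve. all: by end_near. Qed.

Lemma near_eq_continuous (T U : topologicalType) (f g : T -> U) (x : T) :
  (\forall y \near x, f y = g y) -> {for x, continuous f} -> {for x, continuous g}.
Proof.
move=> fg cf; rewrite /prop_for /continuous_at -(nbhs_singleton fg).
by apply: cvg_trans cf; exact: near_eq_cvg.
Qed.

Section ClassC.
Context {R : realType} {m : nat}.
Implicit Types (U : set 'rV[R]_m) (f g : 'rV[R]_m -> R).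

Lemma open_near_eq U f g u : open U -> (forall v, U v -> f v = g v) -> U u ->
  \forall v \near u, f v = g v.
Proof. by move=> oU fg Uu; have := open_nbhs_nbhs (conj oU Uu); apply: filterS. Qed.

Lemma class_CS r U f : class_C r.+1 U f -> class_C r U f.
Proof.
elim: r f => [f [df _] u Uu|r ih f [df cf]]; first exact/differentiable_continuous/df.
by split=> // i; apply: ih; exact: cf.
Qed.

(** Lets a partial derivative be replaced by an explicit formula that is valid on U only; the
    closure properties below rest on this. *)
Lemma class_C_ext r U f g : open U -> (forall v, U v -> f v = g v) ->
  class_C r U f -> class_C r U g.
Proof.
move=> oU; elim: r f g => [|r ih] f g fg /=.
  by move=> cf u Uu; apply: near_eq_continuous (cf u Uu); exact: open_near_eq fg Uu.
move=> [df cf]; split=> [u Uu|i].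
  by apply: near_eq_differentiable (df u Uu); exact: open_near_eq fg Uu.
apply: ih (cf i) => v Uv; apply: near_eq_derive.
exact: open_near_eq fg Uv.
Qed.

Lemma class_C_cst r U (c : R) : open U -> class_C r U (fun=> c).
Proof.
move=> oU; elim: r c => [|r ih] c /=; first by move=> u _; exact: cst_continuous.
split=> [u Uu|i]; first exact: differentiable_cst.
apply: class_C_ext oU _ (ih 0) => v _; by rewrite /partial_der derive_cst.
Qed.

Lemma class_C_coord r U (j : 'I_m) : open U -> class_C r U (fun u => u 0 j).
Proof.
move=> oU; case: r => [u _|r]; first exact: coord_continuous.
split=> [u _|i]; first exact: differentiable_coord.
apply: class_C_ext oU _ (class_C_cst r U ((delta_mx 0 i : 'rV[R]_m) 0 j) oU) => v _.
rewrite /partial_der.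
have h := derive_mx (@derivable_id _ _ v (delta_mx 0 i)).
by move/rowP : h => /(_ j); rewrite derive_id [in RHS]mxE.
Qed.

Lemma class_CD r U f g : open U -> class_C r U f -> class_C r U g ->
  class_C r U (fun u => f u + g u).
Proof.
move=> oU; elim: r f g => [|r ih] f g /=.
  by move=> cf cg u Uu; exact: (continuousD (cf u Uu) (cg u Uu)).
move=> [df cf] [dg cg]; split=> [u Uu|i].
  by apply: differentiableD; [exact: df | exact: dg].
apply: class_C_ext oU _ (ih _ _ (cf i) (cg i)) => v Uv.
by rewrite /partial_der deriveD//; apply: diff_derivable; [exact: df | exact: dg].
Qed.

Lemma class_CM r U f g : open U -> class_C r U f -> class_C r U g ->
  class_C r U (fun u => f u * g u).
Proof.
move=> oU; elim: r f g => [|r ih] f g.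
  by move=> cf cg u Uu; exact: (continuousM (cf u Uu) (cg u Uu)).
(* The product rule also contains the undifferentiated factors, which the induction needs at the
   lower order. *)
move=> cf1 cg1; have cf0 := class_CS _ _ _ cf1; have cg0 := class_CS _ _ _ cg1.
move: cf1 cg1 => [df cf] [dg cg]; split=> [u Uu|i].
  by apply: differentiableM; [exact: df | exact: dg].
apply: class_C_ext oU _ (class_CD _ _ _ _ oU (ih _ _ cf0 (cg i)) (ih _ _ cg0 (cf i))) => v Uv.
by rewrite /partial_der deriveM//; apply: diff_derivable; [exact: df | exact: dg].
Qed.

Lemma class_CN r U f : open U -> class_C r U f -> class_C r U (fun u => - f u).
Proof.
move=> oU cf; apply: (class_C_ext _ _ (fun u => -1 * f u) _ oU) => [v _|].
  by rewrite mulN1r.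
by apply: class_CM => //; exact: class_C_cst.
Qed.

Lemma class_C_sum r U n (f : 'I_n -> 'rV[R]_m -> R) : open U ->
  (forall i, class_C r U (f i)) -> class_C r U (fun u => \sum_i f i u).
Proof.
move=> oU; elim: n f => [|n ih] f cf.
  apply: class_C_ext oU _ (class_C_cst r U 0 oU) => v _; by rewrite big_ord0.
apply: class_C_ext oU _ (class_CD _ _ _ _ oU (ih (fun i => f (lift ord0 i)) _) (cf ord0)).
  by move=> v _; rewrite big_ord_recl addrC.
by move=> i.
Qed.
End ClassC.

Section PartialDerivatives.
Context {R : realType} {m : nat}.
Implicit Types (U : set 'rV[R]_m) (u v : 'rV[R]_m).

Lemma is_derive_line (f : 'rV[R]_m -> R) u v df :
  is_derive u v f df <-> is_derive (0 : R) 1 (fun h => f (h *: v + u)) df.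
Proof.
have e : (fun h : R => h^-1 *: ((f \o shift u) (h *: v) - f u)) =
  (fun h : R => h^-1 *: (((fun h => f (h *: v + u)) \o shift 0) (h *: 1) -
    (fun h => f (h *: v + u)) 0)).
  by apply/funext => h /=; rewrite addr0 scale0r add0r [_%:A]mulr1.
split=> -[c d]; split.
- by move: c; rewrite derivable1P.
- by rewrite -d /derive -e.
- by rewrite derivable1P.
- by rewrite -d /derive -e.
Qed.

Lemma partial_der_lincomb n (f : 'I_n -> 'rV[R]_m -> R) (c : 'I_n -> R) i u :
  (forall k, differentiable (f k) u) ->
  partial_der i (fun v => \sum_k f k v * c k) u = \sum_k partial_der i (f k) u * c k.
Proof.
move=> df; rewrite /partial_der.
have -> : (fun v => \sum_k f k v * c k) = \sum_k (c k \*: f k).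
  apply/funext => v; rewrite fct_sumE; apply: eq_bigr => k _.
  by rewrite /= mulrC.
rewrite derive_sum; last by move=> k; apply: derivableZ; exact: diff_derivable.
by apply: eq_bigr => k _; rewrite deriveZ; [rewrite mulrC | exact: diff_derivable].
Qed.

Lemma differentiable_rowP n (psi : 'rV[R]_m -> 'rV[R]_n) u :
  (forall j, differentiable (fun v => psi v 0 j) u) -> differentiable psi u.
Proof.
move=> dpsi; have -> : psi = \sum_j (fun v => psi v 0 j *: (delta_mx 0 j : 'rV[R]_n)).
  by apply/funext => v; rewrite fct_sumE [LHS]row_sum_delta.
by apply: differentiable_sum => j; exact: differentiableZl.
Qed.

Lemma jacobianE n (psi : 'rV[R]_m -> 'rV[R]_n) u i j :
  (forall j, differentiable (fun v => psi v 0 j) u) ->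
  'J psi u i j = partial_der i (fun v => psi v 0 j) u.
Proof.
move=> /differentiable_rowP dpsi.
have := deriveEjacobian (delta_mx 0 i) dpsi.
rewrite -rowE derive_mx; last exact: diff_derivable.
by move/rowP => /(_ j); rewrite !mxE.
Qed.

Lemma partial_der_coord i j u : partial_der i (fun v => v 0 j) u = (i == j)%:R.
Proof.
have /rowP/(_ j) := derive_mx (@derivable_id _ _ u (delta_mx 0 i)).
by rewrite derive_id [in RHS]mxE mxE eqxx eq_sym => ->.
Qed.

Lemma is_derive_dotp u v : is_derive u v (fun x => dotp x x) (2 * dotp u v).
Proof.
apply/is_derive_line.
have -> : (fun h => dotp (h *: v + u) (h *: v + u)) =
   (fun h => h * (h * dotp v v) + (2 * dotp u v) * h + dotp u u).
  by apply/funext => h; rewrite !(dotpDl, dotpDr, dotpZl, dotpZr) (dotpC v u); ring.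
apply: is_derive_eq.
by rewrite /GRing.scale /=; ring.
Qed.
End PartialDerivatives.

(** * The graph chart of a hemisphere *)

Section Graph.
Context {R : realType} {d : nat}.
Implicit Types (u v : 'rV[R]_d).

Definition unit_ball : set 'rV[R]_d := [set u | dotp u u < 1].

Definition height u : R := Num.sqrt (1 - dotp u u).

(** Coordinate [ord0] carries the height, so the chart is centred at the first axis vector and the
    other coordinates are those of the ball. *)
Definition graph u : 'rV[R]_d.+1 :=
  \row_j if unlift ord0 j is Some i then u 0 i else height u.

Lemma graph0 u : graph u 0 ord0 = height u.
Proof. by rewrite mxE unlift_none. Qed.

Lemma graphS u i : graph u 0 (lift ord0 i) = u 0 i.
Proof. by rewrite mxE liftK. Qed.

Lemma height_gt0 u : unit_ball u -> 0 < height u.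
Proof. by move=> h; rewrite sqrtr_gt0 subr_gt0. Qed.

Lemma height_sqr u : unit_ball u -> height u ^+ 2 = 1 - dotp u u.
Proof. by move=> h; rewrite sqr_sqrtr // subr_ge0 ltW. Qed.

Lemma class_C_dotp r U : open U -> class_C r U (fun u => dotp u u).
Proof.
by move=> oU; apply: class_C_sum => // i; apply: class_CM => //; exact: class_C_coord.
Qed.

Lemma open_unit_ball : open unit_ball.
Proof.
have c : continuous (fun u => dotp u u) by move=> u; exact: (class_C_dotp 0 setT openT).
have -> : unit_ball = (fun u => dotp u u) @^-1` [set x | x < 1] by [].
by apply: open_comp; [move=> x _; exact: c | exact: open_lt].
Qed.

Lemma is_derive_height u v : unit_ball u ->
  is_derive u v height (- dotp u v / height u).
Proof.
move=> Uu; have h0 := height_gt0 _ Uu.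
apply/is_derive_line.
have hd : is_derive (0 : R) 1 (fun h => 1 - dotp (h *: v + u) (h *: v + u)) (- (2 * dotp u v)).
  have /is_derive_line hd := is_derive_dotp u v.
  have hd1 := is_derive_add _ _ _ _ _ (is_derive_const 1 _) (is_derive_opp _ _ _ hd).
  by apply: (is_derive_eq hd1); rewrite add0r.
have q0 : 0 < 1 - dotp (0 *: v + u) (0 *: v + u) by rewrite scale0r add0r subr_gt0.
have hs := is_derive_sqrtf (fun h => 1 - dotp (h *: v + u) (h *: v + u)) 0 _ q0 hd.
apply: (is_derive_eq hs).
rewrite /= scale0r add0r -/(height u); field; exact: lt0r_neq0.
Qed.

Lemma differentiable_height u : unit_ball u -> differentiable height u.
Proof.
move=> Uu; apply: (@differentiable_comp _ _ _ _ (fun u => 1 - dotp u u) Num.sqrt).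
  apply: differentiableB; first exact: differentiable_cst.
  by have [+ _] := class_C_dotp 1 setT openT; apply.
apply/derivable1_diffP; have q0 : 0 < 1 - dotp u u by rewrite subr_gt0.
by have [] := is_derive1_sqrt q0.
Qed.

Lemma partial_der_height i u : unit_ball u ->
  partial_der i height u = - u 0 i / height u.
Proof.
move=> Uu; rewrite /partial_der (@derive_val _ _ _ _ _ _ _ (is_derive_height u (delta_mx 0 i) Uu)).
congr (- _ / _); rewrite /dotp (bigD1 i) //= big1 => [|j ji]; last first.
  by rewrite mxE eqxx (negPf ji) mulr0.
by rewrite mxE !eqxx mulr1 addr0.
Qed.

Lemma differentiable_height_inv u : unit_ball u -> differentiable (fun v => (height v)^-1) u.
Proof.
move=> Uu; apply: differentiableV; first exact: differentiable_height.
by rewrite gt_eqF ?height_gt0.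
Qed.

Lemma partial_der_height_inv i u : unit_ball u ->
  partial_der i (fun v => (height v)^-1) u = u 0 i * (height u)^-1 ^+ 3.
Proof.
move=> Uu; have h0 := height_gt0 _ Uu.
have hd := is_derive_height u (delta_mx 0 i) Uu.
have := partial_der_height i u Uu; rewrite /partial_der.
rewrite deriveV; [|by rewrite gt_eqF|by apply: diff_derivable; exact: differentiable_height].
by move=> ->; rewrite /GRing.scale /=; field; exact: lt0r_neq0.
Qed.

(** The two claims go together because the partial derivatives of both functions are polynomials in
    the coordinates and 1 / height. *)
Lemma class_C_height r :
  class_C r unit_ball height /\ class_C r unit_ball (fun u => (height u)^-1).
Proof.
have oU := open_unit_ball.
elim: r => [|r [ih1 ih2]].
  split=> u Uu; apply: differentiable_continuous.
    exact: differentiable_height.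
  exact: differentiable_height_inv.
split; split.
- exact: differentiable_height.
- move=> i; apply: (class_C_ext _ _ (fun u => (- u 0 i) * (height u)^-1) _ oU).
    by move=> v Uv; rewrite partial_der_height.
  by apply: class_CM => //; apply: class_CN => //; exact: class_C_coord.
- exact: differentiable_height_inv.
- move=> i; apply: (class_C_ext _ _ (fun u => u 0 i *
     ((height u)^-1 * ((height u)^-1 * (height u)^-1))) _ oU).
    by move=> v Uv; rewrite partial_der_height_inv.
  by apply: class_CM => //; [exact: class_C_coord | by apply: class_CM => //; apply: class_CM].
Qed.

Lemma smooth_graph j : smooth_on unit_ball (fun u => graph u 0 j).
Proof.
move=> r; have oU := open_unit_ball.
case: (unliftP ord0 j) => [i|] ->.
  apply: class_C_ext oU _ (class_C_coord r unit_ball i oU) => v _; by rewrite graphS.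
apply: class_C_ext oU _ (class_C_height r).1 => v _; by rewrite graph0.
Qed.

Lemma sphere_graph u : unit_ball u -> sphere (graph u).
Proof.
move=> Uu; rewrite /sphere /= /enorm /dotp big_ord_recl !graph0 -expr2 height_sqr//.
by under eq_bigr do rewrite !graphS; rewrite subrK sqrtr1.
Qed.

Lemma jacobian_graphS u i k : unit_ball u -> 'J graph u i (lift ord0 k) = (i == k)%:R.
Proof.
move=> Uu; rewrite jacobianE; last by move=> j; have [+ _] := smooth_graph j 1; exact.
apply: (etrans (f_equal (fun f => partial_der i f u) _) (partial_der_coord i k u)).
by apply/funext => v; rewrite graphS.
Qed.

Lemma jacobian_graph0 u i : unit_ball u -> 'J graph u i ord0 = - u 0 i / height u.
Proof.
move=> Uu; rewrite jacobianE; last by move=> j; have [+ _] := smooth_graph j 1; exact.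
apply: (etrans (f_equal (fun f => partial_der i f u) _) (partial_der_height i u Uu)).
by apply/funext => v; rewrite graph0.
Qed.

Lemma round_metric_graph u : unit_ball u ->
  round_metric graph u = 1%:M + (height u)^-1 ^+ 2 *: (u^T *m u).
Proof.
move=> Uu; apply/matrixP => i k; rewrite [LHS]mxE.
under eq_bigr do rewrite [X in _ * X]mxE.
rewrite big_ord_recl !jacobian_graph0// addrC ![in RHS]mxE; congr (_ + _).
  under eq_bigr do rewrite !jacobian_graphS//.
  rewrite (bigD1 i) //= big1 => [|j ji]; last by rewrite eq_sym (negPf ji) mul0r.
  by rewrite eqxx mul1r addr0 eq_sym.
by rewrite big_ord1 mxE; have h0 := height_gt0 _ Uu; field; exact: lt0r_neq0.
Qed.

Lemma mulmx_self u : u *m u^T = (dotp u u)%:M.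
Proof. by rewrite [LHS]mx11_scalar -dotpE. Qed.

(** The inverse of a rank one perturbation of the identity; its coefficient is exactly -1 because
    height^2 + |u|^2 = 1. *)
Lemma round_metric_graph_mulV u : unit_ball u ->
  round_metric graph u *m (1%:M - u^T *m u) = 1%:M.
Proof.
move=> Uu; have h0 := height_gt0 _ Uu.
rewrite round_metric_graph// mulmxBr mulmx1 mulmxDl mul1mx -scalemxAl.
have -> : u^T *m u *m (u^T *m u) = dotp u u *: (u^T *m u).
  by rewrite mulmxA -(mulmxA u^T) mulmx_self mul_mx_scalar scalemxAl.
rewrite scalerA -[X in _ - (X + _)]scale1r -scalerDl -addrA -scalerBl.
rewrite [X in X *: _](_ : _ = 0) ?scale0r ?addr0//.
have -> : dotp u u = 1 - height u ^+ 2 by rewrite height_sqr//; ring.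
by field; exact: lt0r_neq0.
Qed.

Lemma invmx_round_metric_graph u : unit_ball u ->
  invmx (round_metric graph u) = 1%:M - u^T *m u.
Proof.
move=> Uu; have h := round_metric_graph_mulV u Uu.
have [U1 _] := mulmx1_unit h.
by rewrite -[RHS](mulKmx U1) h mulmx1.
Qed.

(* Two block factorizations of [[1, - c u], [u^T, 1]]. *)
Lemma det_rank1 (c : R) u : \det (1%:M + c *: (u^T *m u)) = 1 + c * dotp u u.
Proof.
pose A : 'M[R]_(1 + d) := block_mx 1%:M (- (c *: u)) u^T 1%:M.
have e1 : A = block_mx 1%:M 0 u^T 1%:M *m
    block_mx 1%:M (- (c *: u)) 0 (1%:M + c *: (u^T *m u)).
  rewrite mulmx_block !mul1mx !mul0mx !mulmx1 !addr0 ?mulmx0 ?addr0 mulmxN -scalemxAr.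
  by rewrite addrCA addNr addr0.
have e2 : A = block_mx (1%:M + c *: (u *m u^T)) (- (c *: u)) 0 1%:M *m
    block_mx 1%:M 0 u^T 1%:M.
  rewrite mulmx_block !mulmx1 !mul0mx !mulmx0 !mul1mx !add0r mulNmx -scalemxAl.
  by rewrite addrK.
have := congr1 (fun M => \det M) e1; rewrite [in LHS]e2 !det_mulmx.
rewrite !det_lblock !det_ublock !det1 !mul1r !mulr1 mulmx_self => <-.
by rewrite det_mx11 !mxE /= !mulr1n.
Qed.

Lemma vol_density_graph u : unit_ball u -> vol_density graph u = (height u)^-1.
Proof.
move=> Uu; have h0 := height_gt0 _ Uu.
rewrite /vol_density round_metric_graph// det_rank1.
have -> : dotp u u = 1 - height u ^+ 2 by rewrite height_sqr//; ring.
rewrite (_ : 1 + _ = (height u)^-1 ^+ 2).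
  by rewrite sqrtr_sqr ger0_norm // invr_ge0 ltW.
by field; exact: lt0r_neq0.
Qed.

Lemma sphere_param_graph : sphere_param unit_ball graph.
Proof.
split.
- exact: open_unit_ball.
- exact: smooth_graph.
- exact: sphere_graph.
- move=> u v _ _ uv; apply/rowP => i.
  by rewrite -graphS uv graphS.
(* With J J^T = g, this is the right inverse J^T g^-1 of J. *)
- move=> u Uu; apply/row_freeP; exists (('J graph u)^T *m (1%:M - u^T *m u)).
  by rewrite mulmxA; exact: round_metric_graph_mulV.
Qed.
End Graph.

(** * Rotated charts and invariance of the Laplacian *)

Section Rotation.
Context {R : realType} {d : nat}.
Implicit Types (U : set 'rV[R]_d) (psi : 'rV[R]_d -> 'rV[R]_d.+1) (G : 'M[R]_d.+1).

Lemma smooth_lincomb U n (f : 'I_n -> 'rV[R]_d -> R) (c : 'I_n -> R) : open U ->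
  (forall k, smooth_on U (f k)) -> smooth_on U (fun u => \sum_k f k u * c k).
Proof.
move=> oU sf r; apply: class_C_sum => // k; apply: class_CM => //; first exact: sf.
exact: class_C_cst.
Qed.

Lemma smooth_differentiable U (f : 'rV[R]_d -> R) (u : 'rV[R]_d) :
  smooth_on U f -> U u -> differentiable f u.
Proof. by move=> /(_ 1%N) [+ _]; apply. Qed.

Lemma smooth_partial_der U (f : 'rV[R]_d -> R) i : smooth_on U f -> smooth_on U (partial_der i f).
Proof. by move=> sf r; have [_ h] := sf r.+1; exact: h. Qed.

Lemma jacobian_rot U psi G u : sphere_param U psi -> U u ->
  'J (fun v => psi v *m G) u = 'J psi u *m G.
Proof.
case=> oU spsi _ _ _ Uu; apply/matrixP => i j; rewrite [RHS]mxE.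
have dpsi k : differentiable (fun v => psi v 0 k) u.
  exact: smooth_differentiable (spsi k) Uu.
have e k : (fun v => (psi v *m G) 0 k) = (fun v => \sum_l psi v 0 l * G l k).
  by apply/funext => v; rewrite mxE.
have dG k : differentiable (fun v => (psi v *m G) 0 k) u.
  by rewrite e; apply: (smooth_differentiable U _ _ _ Uu); exact: smooth_lincomb.
apply: (etrans (jacobianE _ _ u i j dG)).
rewrite e partial_der_lincomb//; apply: eq_bigr => l _; congr (_ * _).
exact: (esym (jacobianE _ _ u i l dpsi)).
Qed.

Lemma sphere_param_rot U psi G : sphere_param U psi -> orthomx G ->
  sphere_param U (fun u => psi u *m G).
Proof.
move=> sp oG; have [oU spsi sph inj fr] := sp; split.
- exact: oU.
- move=> j; have -> : (fun u => (psi u *m G) 0 j) = (fun u => \sum_l psi u 0 l * G l j).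
    by apply/funext => v; rewrite mxE.
  exact: smooth_lincomb.
- by move=> u Uu; rewrite /sphere /= /enorm dotp_ortho//; exact: sph.
- move=> u v Uu Uv h; apply: inj => //.
  by rewrite -(orthomxK _ G (psi u) oG) h orthomxK.
- move=> u Uu; rewrite (jacobian_rot U)//.
  have /row_freeP [B JB] := fr u Uu.
  by apply/row_freeP; exists (G^T *m B); rewrite mulmxA orthomxK.
Qed.

Lemma round_metric_rot U psi G u : sphere_param U psi -> orthomx G -> U u ->
  round_metric (fun v => psi v *m G) u = round_metric psi u.
Proof.
move=> sp oG Uu; rewrite /round_metric (jacobian_rot U)// trmx_mul mulmxA.
by rewrite orthomxK.
Qed.

Lemma vol_density_rot U psi G u : sphere_param U psi -> orthomx G -> U u ->
  vol_density (fun v => psi v *m G) u = vol_density psi u.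
Proof. by move=> sp oG Uu; rewrite /vol_density (round_metric_rot U). Qed.

Lemma laplace_beltrami_rot U psi G h u : sphere_param U psi -> orthomx G -> U u ->
  laplace_beltrami (fun v => psi v *m G) h u = laplace_beltrami psi h u.
Proof.
move=> sp oG Uu; have [oU _ _ _ _] := sp.
apply: (f_equal2 (fun a b => a^-1 * b) (vol_density_rot _ _ _ _ sp oG Uu)).
apply: eq_bigr => i _; apply: near_eq_derive; apply: open_near_eq oU _ Uu => v Uv.
exact: (f_equal2 (fun a g => a * \sum_j invmx g i j * partial_der j h v)
  (vol_density_rot _ _ _ _ sp oG Uv) (round_metric_rot _ _ _ _ sp oG Uv)).
Qed.

(** Reading the rotated function in [psi] is reading [phi] in the rotated chart, where the metric
    coefficients are the same. *)
Lemma spherical_harmonic_rot n phi G : orthomx G -> @spherical_harmonic R d n phi ->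
  spherical_harmonic n (fun x => phi (x *m G)).
Proof.
move=> oG hphi U psi sp.
have spG := sphere_param_rot U psi G sp oG.
have [sm lap] := hphi U _ spG; split; first exact: sm.
move=> u Uu; exact: (etrans (esym (laplace_beltrami_rot _ _ _ _ _ sp oG Uu)) (lap u Uu)).
Qed.
End Rotation.

(** * The Laplacian in the graph chart *)

Section GraphLaplacian.
Context {R : realType} {d : nat}.
Implicit Types (u v : 'rV[R]_d) (h : 'rV[R]_d -> R).

(** The field (det g)^(1/2) g^ij d_j h whose divergence enters the Laplacian, with the density 1 /
    height and the inverse metric of this chart inserted. *)
Definition graph_flux (i : 'I_d) h v : R :=
  (height v)^-1 * \sum_j ((i == j)%:R - v 0 i * v 0 j) * partial_der j h v.

Lemma laplace_beltrami_graph h u : unit_ball u ->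
  laplace_beltrami graph h u = height u * \sum_i partial_der i (graph_flux i h) u.
Proof.
move=> Uu; rewrite /laplace_beltrami vol_density_graph// invrK; congr (_ * _).
apply: eq_bigr => i _; apply: near_eq_derive.
apply: open_near_eq open_unit_ball _ Uu => v Uv.
rewrite vol_density_graph// invmx_round_metric_graph//; congr (_ * _).
by apply: eq_bigr => j _; rewrite !mxE big_ord1 !mxE.
Qed.

Lemma smooth_graph_flux i h : smooth_on unit_ball h -> smooth_on unit_ball (graph_flux i h).
Proof.
have oU := @open_unit_ball R d.
move=> sh r; apply: class_CM => //; first exact: (class_C_height r).2.
apply: class_C_sum => // j; apply: class_CM => //; last exact: smooth_partial_der.
apply: class_CD => //; first exact: class_C_cst.
by apply: class_CN => //; apply: class_CM => //; exact: class_C_coord.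
Qed.

Lemma laplace_beltrami_lincomb n (h : 'I_n -> 'rV[R]_d -> R) (c : 'I_n -> R) u :
  (forall k, smooth_on unit_ball (h k)) -> unit_ball u ->
  laplace_beltrami graph (fun v => \sum_k h k v * c k) u =
  \sum_k laplace_beltrami graph (h k) u * c k.
Proof.
move=> sh Uu; rewrite laplace_beltrami_graph//.
under [RHS]eq_bigr do rewrite laplace_beltrami_graph// -mulrA.
rewrite -mulr_sumr; congr (_ * _).
under [RHS]eq_bigr do rewrite mulr_suml.
rewrite exchange_big /=; apply: eq_bigr => i _.
rewrite -partial_der_lincomb; last first.
  by move=> k; apply: smooth_differentiable Uu; exact: smooth_graph_flux.
apply: near_eq_derive; apply: open_near_eq open_unit_ball _ Uu => v Uv.
rewrite /graph_flux; under [RHS]eq_bigr do rewrite -mulrA.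
rewrite -mulr_sumr; congr (_ * _).
under [RHS]eq_bigr do rewrite mulr_suml.
rewrite exchange_big /=; apply: eq_bigr => j _.
rewrite partial_der_lincomb; last by move=> k; exact: smooth_differentiable (sh k) Uv.
by rewrite mulr_sumr; apply: eq_bigr => k _; rewrite mulrA.
Qed.

Lemma unit_ball_coord u i : unit_ball u -> -1 < u 0 i < 1.
Proof.
rewrite /unit_ball /= /dotp (bigD1 i) //= => h.
have : 0 <= \sum_(j < d | j != i) u 0 j * u 0 j.
  by apply: sumr_ge0 => j _; rewrite -expr2 sqr_ge0.
by move=> h2; nra.
Qed.

Lemma is_derive_comp_coord (F : R -> R) (f' : R) u i k :
  is_derive (u 0 i) 1 F f' ->
  is_derive u (delta_mx 0 k) (fun v => F (v 0 i)) ((k == i)%:R * f').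
Proof.
move=> hF; apply/is_derive_line.
have -> : (fun s : R => F ((s *: delta_mx 0 k + u) 0 i)) =
    F \o (fun s : R => s * (k == i)%:R + u 0 i).
  by apply/funext => s /=; rewrite !mxE eqxx /= eq_sym.
have hl : is_derive (0 : R) 1 (fun s : R => s * (k == i)%:R + u 0 i) (k == i)%:R.
  have h1 := is_derive_add _ _ _ _ _
    (is_derive_mul _ _ _ _ _ (is_derive_var 0) (is_derive_const (k == i)%:R 0))
    (is_derive_const (u 0 i) 0).
  by apply: (is_derive_eq h1); rewrite mul1r mul0r !addr0.
have hF0 : is_derive (0 * (k == i)%:R + u 0 i) 1 F f' by rewrite mul0r add0r.
have hc := @is_derive1_comp _ F _ 0 _ _ hF0 hl.
by apply: (is_derive_eq hc); rewrite mulrC.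
Qed.

Lemma partial_der_mul3 (f g h : 'rV[R]_d -> R) (f' g' h' : R) i u :
  is_derive u (delta_mx 0 i) f f' -> is_derive u (delta_mx 0 i) g g' ->
  is_derive u (delta_mx 0 i) h h' ->
  partial_der i (fun v => f v * (g v * h v)) u =
    f' * (g u * h u) + f u * (g' * h u + g u * h').
Proof.
move=> hf hg hh; have hgh := is_deriveM hg hh; have H := is_deriveM hf hgh.
have := @derive_val _ _ _ _ _ _ _ H; rewrite /partial_der => ->.
by rewrite /GRing.scale /= (_ : (g * h) u = g u * h u) //; ring.
Qed.

(** The axis of symmetry is an equatorial one, so that the zonal variable is a chart coordinate and
    a single chart yields the equation on all of ]-1, 1[. *)
Lemma laplace_beltrami_zonal (F F' F'' : R -> R) (i0 : 'I_d) u :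
  (forall t : R, -1 < t < 1 -> is_derive t 1 F (F' t)) ->
  (forall t : R, -1 < t < 1 -> is_derive t 1 F' (F'' t)) -> unit_ball u ->
  laplace_beltrami graph (fun v => F (v 0 i0)) u =
  (1 - u 0 i0 ^+ 2) * F'' (u 0 i0) - d%:R * u 0 i0 * F' (u 0 i0).
Proof.
move=> dF dF' Uu; have w0 := height_gt0 _ Uu.
rewrite laplace_beltrami_graph//; set t := u 0 i0.
have -> : \sum_i partial_der i (graph_flux i (fun v => F (v 0 i0))) u =
  \sum_i (u 0 i * (height u)^-1 ^+ 3 * (((i == i0)%:R - u 0 i * t) * F' t) +
  (height u)^-1 * ((- (t + u 0 i * (i == i0)%:R)) * F' t +
     ((i == i0)%:R - u 0 i * t) * ((i == i0)%:R * F'' t))).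
  apply: eq_bigr => i _.
  have -> : partial_der i (graph_flux i (fun v => F (v 0 i0))) u =
    partial_der i (fun v => (height v)^-1 * (((i == i0)%:R - v 0 i * v 0 i0) * F' (v 0 i0))) u.
    apply: near_eq_derive; apply: open_near_eq open_unit_ball _ Uu => v Uv.
    rewrite /graph_flux (bigD1 i0) //= big1 ?addr0 => [|j ji0].
      rewrite /partial_der (@derive_val _ _ _ _ _ _ _
        (is_derive_comp_coord F _ v i0 i0 (dF _ (unit_ball_coord v i0 Uv)))).
      by rewrite eqxx mul1r.
    rewrite /partial_der (@derive_val _ _ _ _ _ _ _
        (is_derive_comp_coord F _ v i0 j (dF _ (unit_ball_coord v i0 Uv)))).
    by rewrite (negPf ji0) mul0r mulr0.
  apply: partial_der_mul3.
  - rewrite -(partial_der_height_inv i u Uu); apply/derivableP/diff_derivable.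
    exact: differentiable_height_inv.
  - have c j : is_derive u (delta_mx 0 i) (fun v => v 0 j) (i == j)%:R.
      have := is_derive_comp_coord id 1 u j i (is_derive_var _); by rewrite mulr1.
    have hm := is_deriveB (is_derive_cst ((i == i0)%:R : R) u (delta_mx 0 i))
      (is_deriveM (c i) (c i0)).
    apply: (is_derive_eq hm).
    by rewrite eqxx /GRing.scale /= mulr1 sub0r addrC.
  - exact: is_derive_comp_coord F' _ u i0 i (dF' _ (unit_ball_coord u i0 Uu)).
(* Regrouped so that the Kronecker terms collapse to i = i0, the squares sum to |u|^2 and the
   constant terms to d. *)
rewrite (eq_bigr (fun i : 'I_d =>
  (i == i0)%:R * (u 0 i * (height u)^-1 ^+ 3 * F' t - (height u)^-1 * u 0 i * F' t
    + (height u)^-1 * ((i == i0)%:R - u 0 i * t) * F'' t)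
  - (height u)^-1 ^+ 3 * t * F' t * (u 0 i * u 0 i) - (height u)^-1 * t * F' t)); last first.
  by move=> i _; ring.
rewrite !sumrB sumr_const card_ord -mulr_sumr -/(dotp u u).
rewrite (bigD1 i0) //= big1 ?addr0 => [|i ii0]; last by rewrite (negPf ii0) mul0r.
rewrite eqxx mulr1n mul1r -/t.
have -> : dotp u u = 1 - height u ^+ 2 by rewrite height_sqr//; ring.
by field; exact: lt0r_neq0.
Qed.
End GraphLaplacian.

(** * Rotation invariance of the volume and of the kernel *)

Section Cover.
Context {disp : measure_display} {T : measurableType disp} {R : realType} {I : eqType}.
Context (A : I -> set T) (mA : forall i, measurable (A i)).

Lemma measurable_cover (s : seq I) : measurable [set x | exists2 i, i \in s & A i x].
Proof.
elim: s => [|i s ih]; first by rewrite (_ : [set _ | _] = set0)//; apply/seteqP; split=> // x [].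
rewrite (_ : [set _ | _] = A i `|` [set x | exists2 i, i \in s & A i x]).
  exact: measurableU.
apply/seteqP; split=> x /=.
  by move=> [j]; rewrite inE => /predU1P[->|js] Ajx; [left | right; exists j].
by move=> [Aix|[j js Ajx]]; [exists i | exists j] => //; rewrite inE ?eqxx ?js ?orbT.
Qed.

(** Made for [sphere_volume], which determines a measure only inside one chart image at a time: each
    step splits B along one piece of the cover. *)
Lemma measure_eq_cover (m1 m2 : {measure set T -> \bar R}) (s : seq I) (B : set T) :
  (forall i C, i \in s -> measurable C -> C `<=` A i -> m1 C = m2 C) ->
  measurable B -> (forall x, B x -> exists2 i, i \in s & A i x) -> m1 B = m2 B.
Proof.
elim: s B => [|i s ih] B h mB BA.
  have -> : B = set0 by apply/seteqP; split=> // x /BA[].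
  by rewrite !measure0.
rewrite (measureDI m1 mB (mA i)) (measureDI m2 mB (mA i)); congr (_ + _)%E.
  apply: ih => [j C js||x [Bx nAx]].
  - by apply: h; rewrite inE js orbT.
  - exact: measurableD.
  - by have [j] := BA x Bx; rewrite inE => /predU1P[->//|js Ajx]; exists j.
apply: (h i); [exact: mem_head | exact: measurableI | exact: subIsetr].
Qed.

Lemma measurable_fun_cover (f : T -> R) (s : seq I) (B : set T) :
  (forall i, measurable_fun (B `&` A i) f) -> measurable B ->
  (forall x, B x -> exists2 i, i \in s & A i x) -> measurable_fun B f.
Proof.
move=> mf mB BA.
have -> : B = B `&` [set x | exists2 i, i \in s & A i x].
  by apply/seteqP; split=> [x Bx|x [] //]; split=> //; exact: BA.
elim: s {BA} => [|i s ih].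
  rewrite (_ : _ `&` _ = set0); first exact: measurable_fun_set0.
  by apply/seteqP; split=> // x [_ []].
rewrite (_ : _ `&` _ = (B `&` A i) `|` (B `&` [set x | exists2 i, i \in s & A i x])).
  apply/measurable_funU; [exact: measurableI | | by split].
  by apply: measurableI => //; exact: measurable_cover.
rewrite -setIUr; congr (_ `&` _); apply/seteqP; split=> x /=.
  by move=> [j]; rewrite inE => /predU1P[->|js] Ajx; [left | right; exists j].
by move=> [Aix|[j js Ajx]]; [exists i | exists j] => //; rewrite inE ?eqxx ?js ?orbT.
Qed.
End Cover.

Lemma patch_eq (X Y : Type) (c : X -> Y) (A B : set X) (f g : X -> Y) :
  A = B -> (forall u, B u -> f u = g u) -> patch c A f = patch c B g.
Proof.
move=> -> fg; apply/funext => u; rewrite /patch; case: ifPn => // /set_mem; exact: fg.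
Qed.

Section SphereMeasure.
Context {R : realType} {d : nat}.
Notation T := (borel_rV R d.+1).
Implicit Types (G : 'M[R]_d.+1) (x a : 'rV[R]_d.+1).

Lemma open_measurable_borel (A : set 'rV[R]_d.+1) : open A -> measurable (A : set T).
Proof. by move=> oA; exact: sub_sigma_algebra. Qed.

Lemma continuous_mulmx (m n : nat) (G : 'M[R]_(m, n)) :
  continuous (fun x : 'rV[R]_m => x *m G).
Proof.
move=> x; apply: differentiable_continuous; apply: differentiable_rowP => j.
have -> : (fun v : 'rV[R]_m => (v *m G) 0 j) = (fun v => \sum_k v 0 k * G k j).
  by apply/funext => v; rewrite mxE.
have [+ _] := class_C_sum 1 setT m (fun k v => v 0 k * G k j) openT
  (fun k => class_CM _ _ _ _ openT (class_C_coord _ _ k openT) (class_C_cst _ _ (G k j) openT)).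
exact.
Qed.

Lemma measurable_rot G : measurable_fun setT (fun x : T => (x : 'rV[R]_d.+1) *m G : T).
Proof.
apply: (@measurability _ _ T T setT _ (@open 'rV[R]_d.+1)) => //.
move=> _ [B oB <-]; rewrite setTI; apply: open_measurable_borel.
by apply: open_comp => // x _; exact: continuous_mulmx.
Qed.

Lemma continuous_dotpl a : continuous (fun x => dotp x a).
Proof.
move=> x; apply: differentiable_continuous.
have [+ _] := class_C_sum 1 setT _ (fun k (v : 'rV[R]_d.+1) => v 0 k * a 0 k) openT
  (fun k => class_CM _ _ _ _ openT (class_C_coord _ _ k openT) (class_C_cst _ _ (a 0 k) openT)).
exact.
Qed.

Lemma sphereE : @sphere R d = [set x | dotp x x = 1].
Proof.
apply/seteqP; split=> x /=.
  by move=> h; rewrite -enorm_sqr h expr1n.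
by rewrite /sphere /= /enorm => ->; rewrite sqrtr1.
Qed.

Lemma measurable_sphere : measurable (@sphere R d : set T).
Proof.
rewrite -[X in measurable X]setCK; apply: measurableC; apply: open_measurable_borel.
rewrite openC sphereE.
have c : continuous (fun u : 'rV[R]_d.+1 => dotp u u).
  by move=> u; exact: (class_C_dotp 0 setT openT).
have -> : [set x : 'rV[R]_d.+1 | dotp x x = 1] = (fun u => dotp u u) @^-1` [set 1] by [].
by apply: closed_comp; [move=> x _; exact: c | exact: closed_eq].
Qed.

Definition halfspace a : set 'rV[R]_d.+1 := [set x | 0 < dotp x a].

Lemma open_halfspace a : open (halfspace a).
Proof.
have -> : halfspace a = (fun x => dotp x a) @^-1` [set t | 0 < t] by [].
by apply: open_comp; [move=> x _; exact: continuous_dotpl | exact: open_gt].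
Qed.

(** Centres of finitely many charts: a unit vector has a nonzero coordinate, hence lies in the open
    hemisphere around some signed axis. *)
Definition axes : seq 'rV[R]_d.+1 :=
  [seq delta_mx 0 i | i <- enum 'I_d.+1] ++ [seq - delta_mx 0 i | i <- enum 'I_d.+1].

Lemma axes_unit a : a \in axes -> dotp a a = 1.
Proof.
rewrite mem_cat => /orP[] /mapP[i _ ->].
  by rewrite dotp_delta mxE !eqxx.
by rewrite dotpNl dotpC dotpNl dotp_delta mxE !eqxx opprK.
Qed.

Lemma sphere_cover x : sphere x -> exists2 a, a \in axes & halfspace a x.
Proof.
rewrite sphereE /= => x1.
have [i xi] : exists i, x 0 i != 0.
  apply/not_existsP => h; move: x1; rewrite /dotp big1 ?(eqP _)//.
    by move/eqP; rewrite eq_sym oner_eq0.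
  by move=> i _; have /negP := h i; rewrite negbK => /eqP ->; rewrite mul0r.
have [xi0|xi0|xi0] := ltgtP (x 0 i) 0.
- exists (- delta_mx 0 i).
    by rewrite mem_cat; apply/orP; right; apply/mapP; exists i; rewrite ?mem_enum.
  by rewrite /halfspace /= dotpC dotpNl dotpC dotp_delta oppr_gt0.
- exists (delta_mx 0 i).
    by rewrite mem_cat; apply/orP; left; apply/mapP; exists i; rewrite ?mem_enum.
  by rewrite /halfspace /= dotp_delta.
- by rewrite xi0 eqxx in xi.
Qed.

Lemma exists_ortho_pole a : dotp a a = 1 ->
  exists2 G, orthomx G & (delta_mx 0 ord0 : 'rV[R]_d.+1) *m G = a.
Proof.
move=> a1; have [|G [oG e _]] := exists_reflection (delta_mx 0 ord0) a.
  by rewrite a1 dotp_delta mxE !eqxx.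
by exists G.
Qed.

Definition tail x : 'rV[R]_d := \row_i x 0 (lift ord0 i).

Lemma continuous_tail : continuous tail.
Proof.
move=> x; apply: differentiable_continuous; apply: differentiable_rowP => j.
have -> : (fun v => tail v 0 j) = (fun v => v 0 (lift ord0 j)).
  by apply/funext => v; rewrite mxE.
exact: differentiable_coord.
Qed.

Lemma graph_tail x : dotp x x = 1 -> 0 < x 0 ord0 -> unit_ball (tail x) /\ graph (tail x) = x.
Proof.
rewrite /dotp big_ord_recl => x1 x0.
have h : dotp (tail x) (tail x) = 1 - x 0 ord0 ^+ 2.
  have : dotp (tail x) (tail x) = \sum_(i < d) x 0 (lift ord0 i) * x 0 (lift ord0 i).
    by apply: eq_bigr => i _; rewrite !mxE.
  lra.
split; first by rewrite /unit_ball /= h; nra.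
apply/rowP => j; case: (unliftP ord0 j) => [i|] ->; first by rewrite graphS mxE.
by rewrite graph0 /height h subKr sqrtr_sqr gtr0_norm.
Qed.

Lemma halfspace_graph G x : orthomx G -> sphere x ->
  halfspace ((delta_mx 0 ord0 : 'rV[R]_d.+1) *m G) x ->
  unit_ball (tail (x *m G^T)) /\ graph (tail (x *m G^T)) *m G = x.
Proof.
rewrite sphereE => oG x1 hx.
have [||b g] := graph_tail (x *m G^T).
- by rewrite dotp_ortho//; exact: orthomx_tr.
- move: hx; rewrite /halfspace /= -[X in 0 < X](dotp_ortho G^T); last exact: orthomx_tr.
  by rewrite orthomxK// dotp_delta.
- by split=> //; rewrite g orthomxVK.
Qed.

(** Smoothness is given in charts only. On each hemisphere [phi] is a function continuous on the
    ball, composed with the continuous projection [tail (x *m G^T)]. *)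
Lemma spherical_harmonic_measurable n (phi : 'rV[R]_d.+1 -> R) :
  spherical_harmonic n phi -> measurable_fun (@sphere R d : set T) (phi : T -> R).
Proof.
move=> hphi; apply: (@measurable_fun_cover _ T _ _
    (fun a : seq_sub axes => halfspace (val a) : set T) _ phi (enum {: seq_sub axes})).
- by move=> a; apply: open_measurable_borel; exact: open_halfspace.
- move=> [a /= aa]; have [G oG Ga] := exists_ortho_pole a (axes_unit _ aa).
  have sp := sphere_param_rot _ _ _ (@sphere_param_graph R d) oG.
  have [sm _] := hphi _ _ sp.
  set h := (phi \o _) in sm.
  have oU := @open_unit_ball R d.
  move=> mD; apply: (measurability _ (RGenOInfty.measurableE R)) => //.
  move=> _ [_ [t ->] <-].
  pose W := unit_ball `&` h @^-1` `]t, +oo[%classic.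
  have oW : open W.
    move/continuous_inP : (oU) => /(_ _ h) [+ _]; apply; last exact: interval_open.
    by move=> u /set_mem Uu; exact: (sm 0%N).
  have -> : @sphere R d `&` halfspace a `&` phi @^-1` `]t, +oo[%classic =
    @sphere R d `&` halfspace a `&` (fun x => tail (x *m G^T)) @^-1` W.
    apply/seteqP; split=> x [[sx hx] px]; split=> //;
      have [b g] := halfspace_graph G x oG sx ltac:(by rewrite Ga).
      by split=> //; rewrite /h /= g.
    by move: px => [_]; rewrite /h /= g.
  apply: measurableI => //; apply: open_measurable_borel.
  apply: open_comp => // x _; apply: continuous_comp; first exact: continuous_mulmx.
  exact: continuous_tail.
- exact: measurable_sphere.
- move=> x /sphere_cover [a aa hx]; exists (SeqSub aa) => //; by rewrite mem_enum.
Qed.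

Lemma sphere_rot G x : orthomx G -> sphere x -> sphere (x *m G).
Proof. by rewrite sphereE => oG; rewrite /= dotp_ortho. Qed.

Definition rot G : T -> T := fun x => (x : 'rV[R]_d.+1) *m G.

HB.instance Definition _ G := isMeasurableFun.Build _ _ _ _ (rot G) (measurable_rot G).

(* The chart formulas for V B and V (B G^-1) are integrals of the same function,
   so no integral needs to be computed. *)
Lemma sphere_volume_rot (V : {measure set T -> \bar R}) G (B : set T) :
  sphere_volume V -> orthomx G -> measurable B -> B `<=` @sphere R d ->
  pushforward V (rot G) B = V B.
Proof.
move=> hV oG mB BS.
apply: (@measure_eq_cover _ T R _
  (fun a : seq_sub axes => @sphere R d `&` halfspace (val a) : set T)
   _ (pushforward V (rot G)) V (enum {: seq_sub axes})) => //.
- move=> a; apply: measurableI; first exact: measurable_sphere.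
  by apply: open_measurable_borel; exact: open_halfspace.
- move=> [a /= aa] C _ mC CA; have [P oP Pa] := exists_ortho_pole a (axes_unit _ aa).
  have sp := sphere_param_rot _ _ _ (@sphere_param_graph R d) oP.
  have oGT := orthomx_tr _ oG.
  have sp' := sphere_param_rot _ _ _ sp oGT.
  have Cim : C `<=` (fun u => graph u *m P) @` unit_ball.
    move=> x /CA [sx hx].
    have [b g] := halfspace_graph P x oP sx ltac:(by rewrite Pa).
    by exists (tail (x *m P^T)).
  have preim : rot G @^-1` C `<=` (fun u => graph u *m P *m G^T) @` unit_ball.
    move=> x /= /Cim [u bu e]; exists u => //.
    by rewrite e orthomxK.
  have mpre : measurable (rot G @^-1` C).
    by rewrite -[X in measurable X]setTI; exact: measurable_rot.
  apply: (etrans (hV _ _ sp' _ mpre preim)).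
  apply: (etrans _ (esym (hV _ _ sp _ mC Cim))).
  apply: (f_equal (@lebesgue_int R d)).
  have eqs : unit_ball `&` (fun u => graph u *m P *m G^T) @^-1` (rot G @^-1` C) =
      unit_ball `&` (fun u : 'rV[R]_d => graph u *m P) @^-1` C.
    by apply/seteqP; split=> v [bv]; rewrite /= /rot orthomxVK.
  apply: (patch_eq _ _ _ _ _ _ _ eqs) => u [bu _].
  exact: (f_equal EFin (vol_density_rot _ _ _ _ sp oGT bu)).
- move=> x Bx; have sx := BS x Bx.
  have [a aa hx] := sphere_cover x sx.
  by exists (SeqSub aa) => //; rewrite mem_enum.
Qed.

Lemma integral_sphere_rot (V : {measure set T -> \bar R}) G (f : 'rV[R]_d.+1 -> R) :
  sphere_volume V -> orthomx G ->
  measurable_fun (@sphere R d : set T) (f : T -> R) ->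
  (forall x, 0 <= f x) ->
  (\int[V]_(x in @sphere R d) (f (x *m G))%:E = \int[V]_(x in @sphere R d) (f x)%:E)%E.
Proof.
move=> hV oG mf f0.
have mS := measurable_sphere.
have h1 := @ge0_integral_pushforward _ _ T T R (rot G) (measurable_rot G) V
  (@sphere R d) (fun x => (f x)%:E) mS.
have pre : rot G @^-1` (@sphere R d) = @sphere R d.
  apply/seteqP; split=> x; last exact: sphere_rot.
  by move=> /= h; rewrite -(orthomxK _ G x oG); apply: sphere_rot => //; exact: orthomx_tr.
move: h1; rewrite pre => <-.
- apply: (@eq_measure_integral _ T R _ V (pushforward V (rot G))) => A mA AS.
  exact: sphere_volume_rot.
- exact/measurable_EFinP.
- by move=> x _; rewrite lee_fin.
Qed.
End SphereMeasure.

(** * The kernel of an orthonormal basis of harmonics *)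

Section Kernel.
Context {R : realType} {d n : nat}.
Notation T := (borel_rV R d.+1).
Context (V : {measure set T -> \bar R}) (hV : sphere_volume V).
Context (phi : 'I_(harm_dim d n) -> 'rV[R]_d.+1 -> R) (hphi : harm_orthonormal_basis V phi).
Notation k := (harm_dim d n).
Notation S := (@sphere R d).

Definition harm_vec (x : 'rV[R]_d.+1) : 'rV[R]_k := \row_j phi j x.

Lemma harm_measurable i : measurable_fun (S : set T) (phi i : T -> R).
Proof. by have [h _ _] := hphi; exact: spherical_harmonic_measurable (h i). Qed.

(** A finite integral means integrability only for the nonnegative squares; mixed products are
    dominated by sums of two squares. *)
Lemma harm_integrable i j : V.-integrable S (fun x => (phi i x * phi j x)%:E).
Proof.
have [_ orth _] := hphi; have mS := @measurable_sphere R d.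
have mij i' j' : measurable_fun (S : set T) (fun x : T => (phi i' x * phi j' x)%:E).
  by apply/measurable_EFinP; apply: measurable_funM; exact: harm_measurable.
have sq l : V.-integrable S (fun x => (phi l x * phi l x)%:E).
  apply/integrableP; split; first exact: mij.
  under eq_integral do rewrite gee0_abs ?lee_fin -?expr2 ?sqr_ge0//.
  by under eq_integral do rewrite expr2; rewrite orth eqxx ltry.
apply: (le_integrable mS (mij i j) _ (integrableD mS (sq i) (sq j))) => x _.
rewrite /= lee_fin [leRHS]ger0_norm; last by rewrite addr_ge0 // -expr2 sqr_ge0.
by rewrite ler_norml; apply/andP; split; nra.
Qed.

Lemma integral_quadratic (b : 'rV[R]_k) :
  (\int[V]_(x in S) (dotp b (harm_vec x) ^+ 2)%:E = (dotp b b)%:E)%E.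
Proof.
have [_ orth _] := hphi; have mS := @measurable_sphere R d.
have e x : ((dotp b (harm_vec x) ^+ 2)%:E =
  \sum_(p : 'I_k * 'I_k) (b 0 p.1 * b 0 p.2)%:E * (phi p.1 x * phi p.2 x)%:E)%E.
  rewrite sumEFin -(pair_bigA _ (fun i j => b 0 i * b 0 j * (phi i x * phi j x))) /=.
  congr EFin; rewrite expr2 {1}/dotp mulr_suml; apply: eq_bigr => i _.
  rewrite /dotp mulr_sumr; apply: eq_bigr => j _; rewrite !mxE; ring.
under eq_integral do rewrite e.
rewrite integral_sum//; last first.
  by move=> p; apply: integrableZl => //; exact: harm_integrable.
rewrite (eq_bigr (fun p => (b 0 p.1 * b 0 p.2 * (p.1 == p.2)%:R)%:E)); last first.
  by move=> p _; rewrite integralZl//; [rewrite orth | exact: harm_integrable].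
rewrite sumEFin; congr EFin.
rewrite -(pair_bigA _ (fun i j => b 0 i * b 0 j * (i == j)%:R)) /=; apply: eq_bigr => i _.
rewrite (bigD1 i) //= eqxx mulr1 big1 ?addr0 // => j ji.
by rewrite eq_sym (negPf ji) mulr0.
Qed.

(** A holds the coordinates of the rotated harmonics in the basis. The integral of <b, harm_vec (x
    G)>^2 is |b A|^2 by orthonormality and |b|^2 by rotation invariance, so A is an isometry. *)
Lemma harm_vec_rot G : orthomx G ->
  exists2 A : 'M[R]_k, orthomx A & forall x, S x -> harm_vec (x *m G) = harm_vec x *m A^T.
Proof.
move=> oG; have [harm orth gen] := hphi.
have mS := @measurable_sphere R d.
have h i := gen _ (spherical_harmonic_rot n (phi i) G oG (harm i)).
pose A : 'M[R]_k := \matrix_(i, j) sval (cid (h i)) j.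
have AE x : S x -> harm_vec (x *m G) = harm_vec x *m A^T.
  move=> Sx; apply/rowP => i; rewrite mxE (svalP (cid (h i)) x Sx) mxE.
  by apply: eq_bigr => j _; rewrite !mxE mulrC.
exists A => //; apply: dotp_isometry_ortho => b; apply: EFin_inj.
rewrite -integral_quadratic -(integral_quadratic b).
rewrite -(integral_sphere_rot V G (fun x => dotp b (harm_vec x) ^+ 2)) //.
- apply: eq_integral => x /set_mem Sx; rewrite AE//; congr (_ ^+ 2)%:E.
  by rewrite !dotpE trmx_mul trmxK mulmxA.
- apply: measurable_funX; apply: measurable_sum => i.
  rewrite (_ : (fun x => _) = (fun x : T => b 0 i * phi i x)); last first.
    by apply/funext => x; rewrite mxE.
  by apply: measurable_funM; [exact: measurable_cst | exact: harm_measurable].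
- by move=> x; exact: sqr_ge0.
Qed.

Lemma kernel_rot G x y : orthomx G -> S x -> S y ->
  dotp (harm_vec (x *m G)) (harm_vec (y *m G)) = dotp (harm_vec x) (harm_vec y).
Proof.
move=> oG Sx Sy; have [A oA AE] := harm_vec_rot G oG.
by rewrite !AE// dotp_ortho//; exact: orthomx_tr.
Qed.

Lemma kernel_zonal x y x' y' : S x -> S y -> S x' -> S y' -> dotp x y = dotp x' y' ->
  dotp (harm_vec x) (harm_vec y) = dotp (harm_vec x') (harm_vec y').
Proof.
move=> Sx Sy Sx' Sy' xy; move: (Sx) (Sy) (Sx') (Sy'); rewrite sphereE /= => x1 y1 x1' y1'.
have [||G [oG <- <-]] := exists_ortho_pair x y x' y' _ _ xy.
- by rewrite x1 x1'.
- by rewrite y1 y1'.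
- by rewrite kernel_rot.
Qed.

(** The diagonal of the kernel is constant by zonality, and its integral is k because each basis
    function contributes 1. *)
Lemma sphere_area_kernel x : (0 < k)%N -> S x ->
  sphere_area V / k%:R * dotp (harm_vec x) (harm_vec x) = 1.
Proof.
move=> k0 Sx; set c := dotp _ _; have [_ orth _] := hphi.
have mS := @measurable_sphere R d.
have k0R : 0 < k%:R :> R by rewrite ltr0n.
have : (\int[V]_(x in S) (dotp (harm_vec x) (harm_vec x))%:E = k%:R%:E)%E.
  have e y : ((dotp (harm_vec y) (harm_vec y))%:E = \sum_(i < k) (phi i y * phi i y)%:E)%E.
    by rewrite sumEFin /dotp; congr EFin; apply: eq_bigr => i _; rewrite !mxE.
  under eq_integral do rewrite e.
  rewrite integral_sum//; last by move=> i; exact: harm_integrable.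
  under eq_bigr do rewrite orth eqxx.
  by rewrite sumEFin sumr_const card_ord.
rewrite (eq_integral (cst c%:E)); last first.
  move=> y /set_mem Sy; congr EFin; apply: kernel_zonal => //.
  by move: (Sx) (Sy); rewrite sphereE /= => -> ->.
rewrite integral_cst//= => cV.
have cn : c != 0.
  by apply/eqP => c0; move: cV; rewrite c0 mul0e => -[] /eqP; rewrite eq_sym gt_eqF.
have c0 : 0 < c by rewrite lt_neqAle eq_sym cn dotp_ge0.
(* [sphere_area] uses [fine], which sends infinity to 0. Finiteness follows because a positive
   constant has the finite integral k. *)
have Vfin : V S \is a fin_num.
  move: cV; rewrite fin_numE; case: (V S) => // /eqP.
    by rewrite mulry gtr0_sg// mul1e.
  by rewrite mulrNy gtr0_sg// mul1e.
move: cV; rewrite -(fineK Vfin) -EFinM => -[cV].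
by rewrite /sphere_area mulrAC [X in X / _]mulrC cV divff// gt_eqF.
Qed.
End Kernel.

(** * Regularity of zonal functions at a pole *)

Lemma is_derive_unique (R : realType) (f : R -> R) (x a b : R) :
  is_derive x 1 f a -> is_derive x 1 f b -> a = b.
Proof. by move=> [_ <-] [_ <-]. Qed.

Lemma is_derive_comp1 (R : realType) (f g : R -> R) (x a b : R) :
  is_derive (g x) 1 f a -> is_derive x 1 g b -> is_derive x 1 (fun t => f (g t)) (a * b).
Proof. by move=> hf hg; have := @is_derive1_comp _ f g x _ _ hf hg; rewrite mulrC. Qed.

Lemma near_itv (R : realType) (a b x : R) : a < x < b -> \forall t \near x, a < t < b.
Proof.
move=> axb; have := @near_in_itvoo _ a b x; rewrite in_itv /= => /(_ axb).
by apply: filterS => t; rewrite in_itv.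
Qed.

Lemma is_derive_even (R : realType) (f : R -> R) (a : R) :
  (forall s, -1 < s < 1 -> f (- s) = f s) -> is_derive (0 : R) 1 f a -> a = 0.
Proof.
move=> ev hf.
have h1 : is_derive (0 : R) 1 (fun s => f (- s)) (a * (- 1)).
  by apply: (is_derive_comp1 _ f (fun s => - s) 0); rewrite oppr0.
have h2 : is_derive (0 : R) 1 (fun s => f (- s)) a.
  apply: near_eq_is_derive hf; have : \forall s \near (0 : R), -1 < s < 1 by apply: near_itv; lra.
  by apply: filterS => s s1; rewrite ev.
have := is_derive_unique _ _ _ _ _ h1 h2; lra.
Qed.

Lemma is_derive_continuous (R : realType) (f : R -> R) (x a : R) :
  is_derive x 1 f a -> {for x, continuous f}.
Proof. by move=> [h _]; apply: differentiable_continuous; apply/derivable1_diffP. Qed.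

Section Pole.
Context {R : realType}.

Lemma sqrt_circleK (t : R) : 0 <= t <= 1 -> Num.sqrt (1 - Num.sqrt (1 - t ^+ 2) ^+ 2) = t.
Proof.
move=> t01; rewrite sqr_sqrtr; last by nra.
by rewrite subKr sqrtr_sqr ger0_norm; lra.
Qed.

(** Here k is F read along a line through the pole in a chart centred there. It is differentiable
    and even in s, so k'(0) = 0. With w = sqrt(1 - t^2) the chain rule gives w F'(t) = - t k'(w),
    which tends to 0. *)
Lemma zonal_sol_pole d (lam : R) (F F' F'' k k' : R -> R) :
  (forall t : R, -1 < t < 1 -> is_derive t 1 F (F' t)) ->
  (forall t : R, -1 < t < 1 -> is_derive t 1 F' (F'' t)) ->
  (forall t : R, -1 < t < 1 ->
     (1 - t ^+ 2) * F'' t - d%:R * t * F' t + lam * F t = 0) ->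
  (forall s : R, -1 < s < 1 -> is_derive s 1 k (k' s)) ->
  {for (0 : R), continuous k'} ->
  (forall s : R, -1 < s < 1 -> F (Num.sqrt (1 - s ^+ 2)) = k s) ->
  zonal_sol R d lam F F' F''.
Proof.
move=> dF dF' ode dk ck Fk.
have FE (t : R) : 0 < t <= 1 -> F t = k (Num.sqrt (1 - t ^+ 2)).
  move=> t01; rewrite -Fk ?sqrt_circleK//; first lra.
  have := sqrtr_ge0 (1 - t ^+ 2); have := @sqr_sqrtr _ (1 - t ^+ 2); nra.
have k'0 : k' 0 = 0.
  apply: (is_derive_even _ k); last by apply: dk; lra.
  by move=> s s1; rewrite -!Fk ?sqrrN//; lra.
split => //.
- rewrite FE; last lra.
  rewrite expr1n subrr sqrtr0.
  have ck0 : {for (0 : R), continuous k} by apply: is_derive_continuous (dk 0 _); lra.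
  have : k (Num.sqrt (1 - t ^+ 2)) @[t --> (1 : R)^'-] --> k 0.
    exact: (continuous_cvg _ ck0 circle_cvg).
  apply: cvg_trans; apply: near_eq_cvg; near=> t; apply/esym/FE.
  have t0 : 0 < t by near: t; exact: nbhs_left_gt.
  have t1 : t < 1 by near: t; exact: nbhs_left_lt.
  lra.
- have : - (t * k' (Num.sqrt (1 - t ^+ 2))) @[t --> (1 : R)^'-] --> - (1 * k' 0).
    apply: cvgN; apply: cvgM; first by apply: cvg_at_left_filter; exact: cvg_id.
    exact: (continuous_cvg _ ck circle_cvg).
  rewrite k'0 mulr0 oppr0.
  apply: cvg_trans; apply: near_eq_cvg; near=> t.
  have t0 : 0 < t by near: t; exact: nbhs_left_gt.
  have t1 : t < 1 by near: t; exact: nbhs_left_lt.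
  have t11 : -1 < t < 1 by lra.
  have sp : 0 < Num.sqrt (1 - t ^+ 2) by rewrite sqrtr_gt0; exact: sqr_lt1.
  have s1 : Num.sqrt (1 - t ^+ 2) < 1.
    by have := @sqr_sqrtr _ (1 - t ^+ 2); nra.
  have h1 : is_derive t 1 F (k' (Num.sqrt (1 - t ^+ 2)) * (- t / Num.sqrt (1 - t ^+ 2))).
    have s11 : -1 < Num.sqrt (1 - t ^+ 2) < 1 by lra.
    have h := is_derive_comp1 _ k (fun t => Num.sqrt (1 - t ^+ 2)) t _ _
      (dk _ s11) (is_derive_circle t t11).
    apply: near_eq_is_derive h.
    have : \forall s \near t, 0 < s < 1 by apply: near_itv; lra.
    by apply: filterS => s s01; rewrite FE//; lra.
  rewrite (is_derive_unique _ _ _ _ _ (dF t t11) h1); field; exact: lt0r_neq0.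
Unshelve. all: by end_near. Qed.
End Pole.

(** * Restriction to a coordinate line of the chart *)

Section Lines.
Context {R : realType} {d : nat} (i : 'I_d).
Notation e := (delta_mx 0 i : 'rV[R]_d).

Lemma derive1_line (f : 'rV[R]_d -> R) :
  derive1 (fun s : R => f (s *: e)) = fun s => partial_der i f (s *: e).
Proof.
apply/funext => t; rewrite derive1E /partial_der /derive.
have -> : (fun h : R => h^-1 *: (((fun s : R => f (s *: e)) \o shift t) (h *: 1) - f (t *: e))) =
  (fun h => h^-1 *: ((f \o shift (t *: e)) (h *: e) - f (t *: e))).
  by apply/funext => h /=; rewrite scalerDl [h%:A]mulr1.
by [].
Qed.

Lemma derive1n_line m (f : 'rV[R]_d -> R) :
  derive1n m (fun s : R => f (s *: e)) = fun s => iter m (partial_der i) f (s *: e).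
Proof.
elim: m => [//|m ih]; by rewrite derive1nS ih derive1_line.
Qed.

Lemma unit_ball_line (t : R) : -1 < t < 1 -> unit_ball (t *: e).
Proof. by move=> t1; rewrite /unit_ball /= dotpZl dotpZr dotp_delta mxE !eqxx /= mulr1; nra. Qed.

Lemma is_derive_smooth_line (f : 'rV[R]_d -> R) (t : R) :
  smooth_on unit_ball f -> -1 < t < 1 ->
  is_derive t 1 (fun s : R => f (s *: e)) (partial_der i f (t *: e)).
Proof.
move=> sf t1.
have df : differentiable f (t *: e) by apply: smooth_differentiable sf (unit_ball_line t t1).
apply: DeriveDef; last by rewrite -derive1E derive1_line.
apply/derivable1_diffP; apply: (@differentiable_comp _ _ _ _ (fun s : R => s *: e) f) => //.
Qed.

Lemma smooth_iter_partial_der m (f : 'rV[R]_d -> R) :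
  smooth_on unit_ball f -> smooth_on unit_ball (iter m (partial_der i) f).
Proof. by move=> sf; elim: m => //= m ih; exact: smooth_partial_der. Qed.
End Lines.

(** * The image of the sphere *)

Lemma laplace_beltrami_graph_ext (R : realType) d (h1 h2 : 'rV[R]_d -> R) u :
  (forall v, unit_ball v -> h1 v = h2 v) -> unit_ball u ->
  laplace_beltrami graph h1 u = laplace_beltrami graph h2 u.
Proof.
move=> h12 Uu; apply: (etrans (laplace_beltrami_graph h1 u Uu)).
apply: (etrans _ (esym (laplace_beltrami_graph h2 u Uu))).
apply: (f_equal (fun x => height u * x)); apply: eq_bigr => i _; apply: near_eq_derive.
apply: open_near_eq open_unit_ball _ Uu => v Uv.
apply: (f_equal (fun x => (height v)^-1 * x)); apply: eq_bigr => j _.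
apply: (f_equal (fun x => _ * x)); apply: near_eq_derive.
exact: open_near_eq open_unit_ball h12 Uv.
Qed.

Lemma is_derive_cvg0 (R : realType) (f : R -> R) (a : R) : is_derive (0 : R) 1 f a ->
  s^-1 * (f s - f 0) @[s --> (0 : R)^'] --> a.
Proof.
move=> [+ <-]; rewrite /derivable /derive.
have -> : (fun h : R => h^-1 *: ((f \o shift 0) (h *: 1) - f 0)) =
  (fun s : R => s^-1 * (f s - f 0)) by apply/funext => h /=; rewrite [h%:A]mulr1 addr0.
by [].
Qed.

Lemma cvg_sum_ord (R : realType) (m : nat) (F : set_system R) (FF : Filter F)
    (f : 'I_m -> R -> R) (a : 'I_m -> R) :
  (forall j, f j s @[s --> F] --> a j) ->
  \sum_j f j s @[s --> F] --> \sum_j a j.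
Proof.
elim: m f a => [|m ih] f a fa.
  by rewrite big_ord0; under eq_fun do rewrite big_ord0; exact: cvg_cst.
rewrite big_ord_recl; under eq_fun do rewrite big_ord_recl.
by apply: cvgD; [exact: fa | apply: ih => j; exact: fa].
Qed.

Section ZonalHarmonic.
Context {R : realType} {d n : nat} (hd : (0 < d)%N) (hn : (0 < n)%N).
Notation T := (borel_rV R d.+1).
Context {V : {measure set T -> \bar R}} (hV : sphere_volume V).
Context {phi : 'I_(harm_dim d n) -> 'rV[R]_d.+1 -> R}
  (hphi : harm_orthonormal_basis V phi).
Notation k := (harm_dim d n).
Notation S := (@sphere R d).
Notation harm_vec := (@harm_vec R d n phi).

Let lam : R := (n * (n + d - 1))%N%:R.
Let i0 : 'I_d := Ordinal hd.
Notation e := (delta_mx 0 i0 : 'rV[R]_d).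
Notation north := (delta_mx 0 ord0 : 'rV[R]_d.+1).
Notation east := (delta_mx 0 (lift ord0 i0) : 'rV[R]_d.+1).

(** The division is the truncated one, so it suffices that the numerator reaches the denominator n +
    d - 1. *)
Lemma harm_dim_gt0 : (0 < k)%N.
Proof.
rewrite /harm_dim divn_gt0; last by rewrite subn_gt0 -addn1 leq_add.
apply: leq_trans (_ : (2 * n + d - 1) * 1 <= _)%N.
  by rewrite muln1 leq_sub2r// leq_add2r mul2n -addnn leq_addr.
by rewrite leq_mul2l bin_gt0 orbC leq_sub2r// leq_addl.
Qed.

Lemma eigenvalue_ge : d%:R <= lam.
Proof.
rewrite ler_nat; apply: leq_trans (_ : 1 * d <= _)%N; first by rewrite mul1n.
by rewrite leq_mul// -addnBAC// leq_addl.
Qed.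

(** The coordinate line runs along half a great circle, with the sine of the angle from the north
    pole as parameter. *)
Lemma graph_lineE (t : R) : graph (t *: e) = Num.sqrt (1 - t ^+ 2) *: north + t *: east.
Proof.
apply/rowP => j; case: (unliftP ord0 j) => [i|] ->.
  rewrite graphS !mxE !eqxx /= mulr0 add0r.
  by rewrite (inj_eq (@lift_inj _ ord0)).
rewrite graph0 /height dotpZl dotpZr dotp_axis eqxx mulr1 -expr2.
by rewrite !mxE !eqxx /= mulr1 mulr0 addr0.
Qed.

Lemma sphere_axis i : S (delta_mx 0 i).
Proof. by rewrite sphereE /= dotp_axis eqxx. Qed.

Lemma dotp_graph_line (t a b : R) :
  dotp (graph (t *: e)) (a *: north + b *: east) = Num.sqrt (1 - t ^+ 2) * a + t * b.
Proof.
have e1 : (ord0 == lift ord0 i0) = false by exact: negPf (neq_lift ord0 i0).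
have e2 : (lift ord0 i0 == ord0) = false by rewrite eq_sym.
rewrite graph_lineE !(dotpDl, dotpDr, dotpZl, dotpZr) !dotp_axis !eqxx e1 e2.
by rewrite mulr0n mulr1n; ring.
Qed.

Lemma sphere_graph_line (t : R) : -1 <= t <= 1 -> S (graph (t *: e)).
Proof.
move=> t1; rewrite sphereE /= {2}graph_lineE dotp_graph_line -!expr2 sqr_sqrtr; last by nra.
by rewrite subrK.
Qed.

Let c : R := dotp (harm_vec east) (harm_vec east).

Lemma kernel_norm_gt0 : 0 < c.
Proof.
rewrite lt_neqAle dotp_ge0 andbT eq_sym; apply/eqP => c0.
have := sphere_area_kernel V hV phi hphi east harm_dim_gt0 (sphere_axis _).
by rewrite -/c c0 mulr0 => /eqP; rewrite eq_sym oner_eq0.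
Qed.

(* Z (graph u, z) / Z (z, z): on the sphere Z (z, z) is the constant c. *)
Definition harm_section (z : 'rV[R]_d.+1) (u : 'rV[R]_d) : R :=
  \sum_j phi j (graph u) * (phi j z / c).

Lemma harm_sectionE z u : harm_section z u = dotp (harm_vec (graph u)) (harm_vec z) / c.
Proof.
rewrite /harm_section /dotp mulr_suml; apply: eq_bigr => j _.
by rewrite !mxE mulrA.
Qed.

Lemma smooth_harm_section z : smooth_on unit_ball (harm_section z).
Proof.
apply: smooth_lincomb; first exact: open_unit_ball.
by move=> j; have [harm _ _] := hphi; have [] := harm j _ _ sphere_param_graph.
Qed.

(** As <graph (t e), east> = t, this is the profile F. Its values at 1 and -1 are still correct,
    since [graph] maps the closed ball to the sphere, whereas [zonal1] and [zonal2] are controlled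
    only in ]-1, 1[. *)
Definition zonal (t : R) : R := harm_section east (t *: e).
Definition zonal1 (t : R) : R := partial_der i0 (harm_section east) (t *: e).
Definition zonal2 (t : R) : R :=
  partial_der i0 (partial_der i0 (harm_section east)) (t *: e).

Lemma kernel_zonalE x y : S x -> S y ->
  dotp (harm_vec x) (harm_vec y) = c * zonal (dotp x y).
Proof.
move=> Sx Sy; rewrite /zonal harm_sectionE mulrC divfK ?gt_eqF ?kernel_norm_gt0//.
have xy : -1 <= dotp x y <= 1.
  by have := dotp_CS x y; move: Sx Sy; rewrite sphereE /= => -> ->; nra.
apply: (kernel_zonal V hV phi hphi) => //; first exact: sphere_graph_line.
  exact: sphere_axis.
have -> : east = 0 *: north + 1 *: east by rewrite scale0r add0r scale1r.
by rewrite dotp_graph_line mulr0 add0r mulr1.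
Qed.

Lemma harm_section_zonal z u : S z -> unit_ball u ->
  harm_section z u = zonal (dotp (graph u) z).
Proof.
move=> Sz Uu; rewrite harm_sectionE kernel_zonalE//; last exact: sphere_graph.
by rewrite mulrC mulKf// gt_eqF// kernel_norm_gt0.
Qed.

Lemma zonal_at1 : zonal 1 = 1.
Proof.
have := kernel_zonalE east east (sphere_axis _) (sphere_axis _).
rewrite dotp_axis eqxx -/c => h; apply: (mulfI (lt0r_neq0 kernel_norm_gt0)).
by rewrite -h mulr1.
Qed.

(** Cauchy-Schwarz: all vectors [harm_vec x] with x on the sphere have the same norm. *)
Lemma zonal_le1 (t : R) : -1 <= t <= 1 -> zonal t <= 1.
Proof.
move=> t1; have c0 := kernel_norm_gt0.
have Sp := sphere_graph_line t t1.
have h := dotp_CS (harm_vec (graph (t *: e))) (harm_vec east).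
move: h; rewrite (kernel_zonalE _ _ Sp Sp) (kernel_zonalE _ _ Sp (sphere_axis _)) -/c.
have -> : dotp (graph (t *: e)) (graph (t *: e)) = 1.
  by move: Sp; rewrite sphereE.
have -> : dotp (graph (t *: e)) east = t.
  have -> : east = 0 *: north + 1 *: east by rewrite scale0r add0r scale1r.
  by rewrite dotp_graph_line mulr0 add0r mulr1.
rewrite zonal_at1 mulr1 -expr2 exprMn => h.
have : zonal t ^+ 2 <= 1.
  by rewrite -(ler_pM2l (exprn_gt0 2 c0)) mulr1.
by nra.
Qed.

Lemma is_derive_zonal (t : R) : -1 < t < 1 -> is_derive t 1 zonal (zonal1 t).
Proof. by move=> t1; apply: is_derive_smooth_line => //; exact: smooth_harm_section. Qed.

Lemma is_derive_zonal1 (t : R) : -1 < t < 1 -> is_derive t 1 zonal1 (zonal2 t).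
Proof.
move=> t1; apply: is_derive_smooth_line => //.
by apply: smooth_partial_der; exact: smooth_harm_section.
Qed.

Lemma dotp_graph_east u : dotp (graph u) east = u 0 i0.
Proof. by rewrite dotp_delta graphS. Qed.

Lemma zonal_ode (t : R) : -1 < t < 1 ->
  (1 - t ^+ 2) * zonal2 t - d%:R * t * zonal1 t + lam * zonal t = 0.
Proof.
move=> t1; have Ut := unit_ball_line i0 t t1.
have [harm _ _] := hphi.
have lap : laplace_beltrami graph (harm_section east) (t *: e) =
    - lam * harm_section east (t *: e).
  rewrite (laplace_beltrami_lincomb _ (fun j => phi j \o graph)) //; last first.
    by move=> j; have [] := harm j _ _ sphere_param_graph.
  rewrite mulr_sumr; apply: eq_bigr => j _.
  have [_ h] := harm j _ _ sphere_param_graph.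
  by rewrite (h _ Ut) [RHS]mulrA.
have := laplace_beltrami_zonal zonal zonal1 zonal2 i0 (t *: e)
  is_derive_zonal is_derive_zonal1 Ut.
rewrite -(laplace_beltrami_graph_ext _ _ (harm_section east)) => [|v Uv|//]; last first.
  by rewrite harm_section_zonal//; [rewrite dotp_graph_east | exact: sphere_axis].
rewrite lap !mxE !eqxx mulr1 -/(zonal t); lra.
Qed.

(** The product with the pole b north is b times the height. The cases b = 1 and b = -1 provide the
    smooth k of [zonal_sol_pole] for regularity at t = 1 and t = -1. *)
Lemma harm_section_pole (b : R) (s : R) : b ^+ 2 = 1 -> -1 < s < 1 ->
  zonal (b * Num.sqrt (1 - s ^+ 2)) = harm_section (b *: north) (s *: e).
Proof.
move=> b1 s1; rewrite harm_section_zonal//; last 2 first.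
- by rewrite sphereE /= dotpZl dotpZr dotp_axis eqxx mulr1 -expr2.
- exact: unit_ball_line.
have -> : b *: north = b *: north + 0 *: east by rewrite scale0r addr0.
by rewrite dotp_graph_line mulr0 addr0 mulrC.
Qed.

Lemma continuous_partial_section z :
  {for (0 : R), continuous (fun s : R => partial_der i0 (harm_section z) (s *: e))}.
Proof.
apply: (@is_derive_continuous _ _ _ (partial_der i0 (partial_der i0 (harm_section z)) (0 *: e))).
apply: is_derive_smooth_line; last by lra.
by apply: smooth_partial_der; exact: smooth_harm_section.
Qed.

Lemma zonal_sol_zonal : zonal_sol R d lam zonal zonal1 zonal2.
Proof.
apply: (zonal_sol_pole _ _ _ _ _ (fun s => harm_section (1 *: north) (s *: e))
  (fun s => partial_der i0 (harm_section (1 *: north)) (s *: e))).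
- exact: is_derive_zonal.
- exact: is_derive_zonal1.
- exact: zonal_ode.
- by move=> s s1; apply: is_derive_smooth_line => //; exact: smooth_harm_section.
- exact: continuous_partial_section.
- by move=> s s1; rewrite -harm_section_pole ?expr1n// mul1r.
Qed.

Lemma zonal_sol_zonal_opp : zonal_sol R d lam (fun t => zonal (- t))
  (fun t => - zonal1 (- t)) (fun t => zonal2 (- t)).
Proof.
have dopp (t : R) : is_derive t 1 (fun t => - t) (- 1).
  by apply: is_derive_opp; exact: is_derive_var.
apply: (zonal_sol_pole _ _ _ _ _ (fun s => harm_section ((-1) *: north) (s *: e))
  (fun s => partial_der i0 (harm_section ((-1) *: north)) (s *: e))).
- move=> t t1; rewrite -[- zonal1 _]mulrN1.
  by apply: is_derive_comp1 (dopp t); apply: is_derive_zonal; lra.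
- move=> t t1; rewrite -[zonal2 _]opprK -[- zonal2 _]mulrN1.
  apply: is_derive_opp.
  by apply: is_derive_comp1 (dopp t); apply: is_derive_zonal1; lra.
- by move=> t t1; have := zonal_ode (- t) ltac:(lra); rewrite sqrrN; lra.
- by move=> s s1; apply: is_derive_smooth_line => //; exact: smooth_harm_section.
- exact: continuous_partial_section.
- by move=> s s1; rewrite -harm_section_pole ?sqrrN ?expr1n// mulN1r.
Qed.

Lemma zonal_bound (t : R) : -1 <= t < 1 ->
  2 * (1 - zonal t) - (1 - t ^+ 2) * zonal1 t ^+ 2 * d%:R / lam <=
    (d%:R + 12) ^+ 2 * (1 - zonal t) ^+ 2.
Proof.
exact: (zonal_estimate zonal_sol_zonal zonal_sol_zonal_opp hd eigenvalue_ge
  zonal_at1 zonal_le1).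
Qed.

Lemma zonal_chord (t : R) : 0 < t < 1 ->
  2 * (1 - zonal t) <= lam / d%:R * (2 / (t * (1 + t))) * (1 - t ^+ 2).
Proof.
exact: (zonal_quotient_le zonal_sol_zonal hd eigenvalue_ge zonal_at1 zonal_le1).
Qed.

Let sig : R := sphere_area V / k%:R.

Lemma sig_c : sig * c = 1.
Proof. exact: (sphere_area_kernel V hV phi hphi east harm_dim_gt0 (sphere_axis _)). Qed.

Lemma sig_gt0 : 0 < sig.
Proof. by rewrite -(pmulr_lgt0 _ kernel_norm_gt0) sig_c. Qed.

Lemma dotp_harm_map x y : S x -> S y ->
  dotp (harm_map V phi x) (harm_map V phi y) = zonal (dotp x y).
Proof.
move=> Sx Sy; rewrite /harm_map -/sig dotpZl dotpZr mulrA -expr2 sqr_sqrtr ?ltW ?sig_gt0//.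
by rewrite (kernel_zonalE x y Sx Sy) mulrA sig_c mul1r.
Qed.

Notation N := (harm_map V phi @` S).

(** The image of the great circle leaving [north *m G] in direction [east *m G]; G will be chosen so
    that the circle starts at y and its plane contains x. *)
Definition harm_curve (G : 'M[R]_d.+1) (s : R) : 'rV[R]_k :=
  harm_map V phi (graph (s *: e) *m G).

Definition harm_tangent G : 'rV[R]_k := derive1 (harm_curve G) 0.

Section Curve.
Context (G : 'M[R]_d.+1) (oG : orthomx G).

Let coord j (u : 'rV[R]_d) : R := Num.sqrt sig * phi j (graph u *m G).

Lemma smooth_coord j : smooth_on unit_ball (coord j).
Proof.
move=> r; have oU := @open_unit_ball R d; apply: class_CM => //; first exact: class_C_cst.
have [harm _ _] := hphi.
by have [sm _] := harm j _ _ (sphere_param_rot _ _ _ sphere_param_graph oG); exact: sm.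
Qed.

Lemma harm_curve_coord j : (fun s => harm_curve G s 0 j) = (fun s => coord j (s *: e)).
Proof. by apply/funext => s; rewrite !mxE. Qed.

Lemma sphere_curve (s : R) : -1 <= s <= 1 -> S (graph (s *: e) *m G).
Proof. by move=> s1; apply: sphere_rot => //; exact: sphere_graph_line. Qed.

Lemma derivable_harm_curve (s : R) : -1 < s < 1 -> derivable (harm_curve G) s 1.
Proof.
move=> s1; apply/derivable_mxP => i j; rewrite (ord1 i) harm_curve_coord.
by have [] := is_derive_smooth_line i0 _ _ (smooth_coord j) s1.
Qed.

Lemma harm_tangent_coord j :
  is_derive (0 : R) 1 (fun s => harm_curve G s 0 j) (harm_tangent G 0 j).
Proof.
have s1 : -1 < (0 : R) < 1 by lra.
rewrite /harm_tangent derive1E derive_mx; last exact: derivable_harm_curve.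
rewrite mxE; apply/derivableP; rewrite harm_curve_coord.
by have [] := is_derive_smooth_line i0 _ _ (smooth_coord j) s1.
Qed.

Lemma is_derive_dotp_curve X :
  is_derive (0 : R) 1 (fun s => dotp X (harm_curve G s)) (dotp X (harm_tangent G)).
Proof.
rewrite (_ : (fun s => _) = \sum_j (X 0 j \*: (fun s => harm_curve G s 0 j))); last first.
  by apply/funext => s; rewrite fct_sumE.
by apply: is_derive_sum => j; apply: is_deriveZ; exact: harm_tangent_coord.
Qed.

Lemma graph_line0 : graph (0 *: e) = north.
Proof. by rewrite graph_lineE expr0n /= subr0 sqrtr1 scale1r scale0r addr0. Qed.

Lemma harm_tangent_in : tangent_space N (harm_map V phi (north *m G)) (harm_tangent G).
Proof.
exists (harm_curve G), 1; split => //.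
- move=> t; rewrite ltr_norml => t1; split.
    by exists (graph (t *: e) *m G) => //; apply: sphere_curve; lra.
  move=> j m; rewrite harm_curve_coord derive1n_line.
  have [+ _] := is_derive_smooth_line i0 _ _
    (smooth_iter_partial_der i0 m _ (smooth_coord j)) t1.
  by [].
- by rewrite /harm_curve graph_line0.
Qed.

Lemma dotp_curve (a b s : R) : a ^+ 2 + b ^+ 2 = 1 -> -1 <= s <= 1 ->
  dotp (harm_map V phi ((a *: north + b *: east) *m G)) (harm_curve G s) =
  zonal (Num.sqrt (1 - s ^+ 2) * a + s * b).
Proof.
move=> ab s1; rewrite /harm_curve dotp_harm_map; last exact: sphere_curve.
  by rewrite dotp_ortho// dotpC dotp_graph_line.
apply: sphere_rot => //; rewrite sphereE /=.
rewrite !(dotpDl, dotpDr, dotpZl, dotpZr) !dotp_axis !eqxx.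
have e1 : (ord0 == lift ord0 i0) = false by exact: negPf (neq_lift ord0 i0).
have e2 : (lift ord0 i0 == ord0) = false by rewrite eq_sym.
by rewrite e1 e2 mulr0n mulr1n; lra.
Qed.

(** The product of the base point with the curve depends on s through s^2 only, so its derivative at
    0 vanishes. *)
Lemma dotp_tangent_base : dotp (harm_map V phi (north *m G)) (harm_tangent G) = 0.
Proof.
apply: (is_derive_even _ _ _ _ (is_derive_dotp_curve _)) => s s1.
have -> : north = 1 *: north + 0 *: east by rewrite scale1r scale0r addr0.
by rewrite !dotp_curve ?sqrrN ?expr1n ?expr0n ?addr0 ?mulr0 ?addr0//; lra.
Qed.

(** Differentiate F (t sqrt(1 - s^2) + s sqrt(1 - t^2)) at s = 0. *)
Lemma dotp_tangent (t : R) : -1 < t < 1 ->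
  dotp (harm_map V phi ((t *: north + Num.sqrt (1 - t ^+ 2) *: east) *m G))
    (harm_tangent G) = zonal1 t * Num.sqrt (1 - t ^+ 2).
Proof.
move=> t1; set b := Num.sqrt _.
have b2 : b ^+ 2 = 1 - t ^+ 2 by rewrite sqr_sqrtr; nra.
apply: (is_derive_unique _ _ _ _ _ (is_derive_dotp_curve _)).
have h : is_derive (0 : R) 1 (fun s => zonal (Num.sqrt (1 - s ^+ 2) * t + s * b))
   (zonal1 t * b).
  apply: (is_derive_comp1 _ zonal (fun s => Num.sqrt (1 - s ^+ 2) * t + s * b)).
    by rewrite expr0n /= subr0 sqrtr1 mul1r mul0r addr0; exact: is_derive_zonal.
  have hc := is_derive_circle (0 : R) ltac:(lra).
  by eapply is_derive_eq; [derive_tac | rewrite /= oppr0 !mul0r; ring].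
apply: near_eq_is_derive h.
have : \forall s \near (0 : R), -1 < s < 1 by apply: near_itv; lra.
by apply: filterS => s s1; rewrite dotp_curve//; lra.
Qed.

Lemma harm_curve_chord (s : R) : -1 <= s <= 1 ->
  dotp (harm_curve G s - harm_curve G 0) (harm_curve G s - harm_curve G 0) =
  2 * (1 - zonal (Num.sqrt (1 - s ^+ 2))).
Proof.
move=> s1; rewrite !(dotpBl, dotpBr) (dotpC (harm_curve G 0) (harm_curve G s)).
have Sx := sphere_curve s s1.
have S0 := sphere_curve 0 ltac:(lra).
rewrite !dotp_harm_map// !dotp_ortho//.
have -> : dotp (graph (s *: e)) (graph (0 *: e)) = Num.sqrt (1 - s ^+ 2).
  rewrite graph_line0 (_ : north = 1 *: north + 0 *: east); last first.
    by rewrite scale1r scale0r addr0.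
  by rewrite dotp_graph_line mulr1 mulr0 addr0.
have u (r : R) : -1 <= r <= 1 -> dotp (graph (r *: e)) (graph (r *: e)) = 1.
  by move=> /sphere_graph_line; rewrite sphereE.
by rewrite !u ?zonal_at1; lra.
Qed.

(** The squared speed is the limit of |gamma(s) - gamma(0)|^2 / s^2, and [zonal_chord] bounds this
    quotient by [b s], which tends to lam / d. *)
Lemma harm_tangent_norm : dotp (harm_tangent G) (harm_tangent G) <= lam / d%:R.
Proof.
pose q (s : R) : R := \sum_j (s^-1 * (harm_curve G s 0 j - harm_curve G 0 0 j)) *
  (s^-1 * (harm_curve G s 0 j - harm_curve G 0 0 j)).
have cq : q s @[s --> (0 : R)^'] --> dotp (harm_tangent G) (harm_tangent G).
  apply: cvg_sum_ord => j.
  by apply: cvgM; apply: (is_derive_cvg0 _ (fun s => harm_curve G s 0 j));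
    exact: harm_tangent_coord.
have qE (s : R) : q s = s^-1 ^+ 2 *
    dotp (harm_curve G s - harm_curve G 0) (harm_curve G s - harm_curve G 0).
  by rewrite /q /dotp mulr_sumr; apply: eq_bigr => j _; rewrite !mxE; ring.
pose b (s : R) : R := lam / d%:R *
  (2 / (Num.sqrt (1 - s ^+ 2) * (1 + Num.sqrt (1 - s ^+ 2)))).
have cb : b s @[s --> (0 : R)^'] --> lam / d%:R.
  have hw : is_derive (0 : R) 1 (fun s => Num.sqrt (1 - s ^+ 2)) _ :=
    is_derive_circle 0 ltac:(lra).
  have w0 := is_derive_continuous _ _ _ _ hw.
  have w1 : Num.sqrt (1 - 0 ^+ 2) = 1 :> R by rewrite expr0n /= subr0 sqrtr1.
  have -> : lam / d%:R = lam / d%:R * (2 * (1 * (1 + 1))^-1) :> R by rewrite mul1r mulfV ?mulr1.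
  have cw : Num.sqrt (1 - s ^+ 2) @[s --> (0 : R)^'] --> (Num.sqrt (1 - 0 ^+ 2) : R).
    by apply: cvg_within_filter; exact: w0.
  rewrite w1 in cw.
  apply: cvgMl_tmp; apply: cvgMl_tmp; apply: cvgV; first by rewrite mul1r.
  by apply: cvgM => //; apply: cvgD => //; exact: cvg_cst.
apply: (ler_cvg_to cq cb); near=> s.
have s0 : s != 0 by near: s; exact: nbhs_dnbhs_neq.
have s1 : -1 < s < 1.
  by near: s; apply: nbhs_dnbhs; apply: near_itv; lra.
have s2 : 0 < s ^+ 2 by rewrite exprn_even_gt0.
have t01 : 0 < Num.sqrt (1 - s ^+ 2) < 1.
  have tp : 0 < Num.sqrt (1 - s ^+ 2) by rewrite sqrtr_gt0; exact: sqr_lt1.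
  rewrite tp /=; have := @sqr_sqrtr _ (1 - s ^+ 2); nra.
rewrite qE harm_curve_chord; last by lra.
have := zonal_chord _ t01; rewrite -/(b s).
have -> : 1 - Num.sqrt (1 - s ^+ 2) ^+ 2 = s ^+ 2 by rewrite sqr_sqrtr ?subKr//; nra.
by move=> h; rewrite exprVn mulrC ler_pdivrMr.
Unshelve. all: by end_near. Qed.
End Curve.

Lemma reach_quotient_ge (X Y : 'rV[R]_k) : N X -> N Y -> X != Y ->
  (((d%:R + 12)^-1)%:E <= reach_quotient N X Y)%E.
Proof.
move=> [x Sx <-] [y Sy <-] XY.
have dR : 1 <= d%:R :> R by rewrite ler1n.
have L0 : 0 < lam by have := eigenvalue_ge; lra.
set t := dotp x y.
have t11 : -1 <= t <= 1.
  by have := dotp_CS x y; move: Sx Sy; rewrite sphereE /= => -> ->; rewrite -/t; nra.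
have b2 : Num.sqrt (1 - t ^+ 2) ^+ 2 = 1 - t ^+ 2 by rewrite sqr_sqrtr; nra.
set b := Num.sqrt (1 - t ^+ 2) in b2.
have e1 : (ord0 == lift ord0 i0) = false by exact: negPf (neq_lift ord0 i0).
have e2 : (lift ord0 i0 == ord0) = false by rewrite eq_sym.
(* Moves the north pole to y and puts x on the great circle of [harm_curve G]. *)
have [|||G [oG Gx Gy]] := exists_ortho_pair (t *: north + b *: east) north x y.
- move: Sx; rewrite sphereE /= => ->.
  rewrite !(dotpDl, dotpDr, dotpZl, dotpZr) !dotp_axis !eqxx e1 e2 mulr0n mulr1n; lra.
- by move: Sy; rewrite sphereE /= => ->; rewrite dotp_axis eqxx.
- by rewrite dotpDl !dotpZl !dotp_axis eqxx e2 mulr0n mulr1n mulr1 mulr0 addr0.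
have t_lt1 : t < 1.
  have [//|t1] := ltP t 1; exfalso; have {}t1 : t = 1 by lra.
  have b0 : b = 0 by rewrite /b t1 expr1n subrr sqrtr0.
  by move/eqP: XY; apply; rewrite -Gx -Gy t1 b0 scale1r scale0r addr0.
set v := harm_map V phi x - harm_map V phi y.
have vv : dotp v v = 2 * (1 - zonal t).
  rewrite /v !(dotpBl, dotpBr) (dotpC (harm_map V phi y)) !dotp_harm_map//.
  by move: (Sx) (Sy); rewrite sphereE /= => -> ->; rewrite zonal_at1; lra.
rewrite /reach_quotient -/v; set p := orth_proj _ _.
have G0 : 0 <= 1 - zonal t by have := zonal_le1 t t11; lra.
have hp : enorm p <= (d%:R + 12) * (1 - zonal t).
  have dp : 0 <= d%:R + 12 :> R by lra.
  have Mp := mulr_ge0 dp G0.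
  rewrite -(@ler_pXn2r _ 2) ?nnegrE ?enorm_ge0//.
  rewrite enorm_sqr exprMn.
  (* Without a projection [xget] returns the default 0, for which the bound is trivial. *)
  rewrite /p /orth_proj; case: xgetP => [p' _ [Wp' vp']|_]; last first.
    by rewrite [X in X <= _](_ : _ = 0) ?mulr_ge0 ?sqr_ge0//; apply/eqP; rewrite dotp_eq0.
  apply: le_trans (zonal_bound t _); last lra.
  have tau_in := harm_tangent_in G oG; rewrite Gy in tau_in.
  have := projection_bound v p' (harm_tangent G) (lam / d%:R) _
    (harm_tangent_norm G oG) (Wp' _ tau_in) (vp' _ Wp').
  rewrite divr_gt0//; last lra.
  move=> /(_ isT) h; apply: le_trans h _; rewrite vv lerD2l lerN2.
  (* At t = -1 [dotp_tangent] does not apply, but the subtracted term of Q has the factor 1 - t^2 =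
     0, so dropping a nonnegative quantity suffices. *)
  have [tm|tm] := eqVneq t (-1).
    rewrite tm sqrrN expr1n subrr !mul0r.
    by rewrite divr_ge0 ?sqr_ge0// divr_ge0; lra.
  have t1 : -1 < t < 1 by rewrite lt_neqAle eq_sym tm; lra.
  have -> : dotp v (harm_tangent G) = zonal1 t * b.
    rewrite /v dotpBl -Gx -Gy (dotp_tangent_base G oG) subr0.
    exact: dotp_tangent.
  rewrite exprMn b2 le_eqVlt; apply/orP; left; apply/eqP.
  have l0 : lam != 0 by rewrite gt_eqF.
  by move: (lam) l0 => l l0; field; rewrite l0 andbT; lra.
case: ifPn => [_|p0]; first exact: leey.
have p_gt0 : 0 < enorm p.
  rewrite lt_neqAle enorm_ge0 andbT eq_sym; apply: contra p0 => /eqP ->.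
  by rewrite mulr0.
(* Since |v|^2 = 2 (1 - F), the quotient is (1 - F) / |p|, and [hp] bounds it below. *)
rewrite lee_fin enorm_sqr vv invfM mulrA [2 * _ / 2]mulrAC divff// mul1r.
rewrite ler_pdivlMr// mulrC ler_pdivrMr; last lra.
by rewrite mulrC.
Qed.
End ZonalHarmonic.

Theorem theorem1p1 (R : realType) (d : nat) (hd : (1 <= d)%N) :
  exists c : R, 0 < c /\
  exists n0 : nat, forall n : nat, (n0 <= n)%N ->
  forall V : {measure set (borel_rV R d.+1) -> \bar R}, sphere_volume V ->
  forall phi : 'I_(harm_dim d n) -> 'rV[R]_d.+1 -> R,
    harm_orthonormal_basis V phi ->
  (c%:E <= reach (harm_map V phi @` @sphere R d))%E.
Proof.
exists (d%:R + 12)^-1; split; first by rewrite invr_gt0 ltr_wpDl.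
(* n >= 1 ensures that the dimension is positive and that d <= lam. *)
exists 1%N => n hn V hV phi hphi; apply: le_ereal_inf_tmp => _ [X [Y [NX NY XY ->]]].
exact: reach_quotient_ge.
Qed.
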